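(* Let $\mathbf{C}$ be the variety of centre-by-metabelian Lie algebras over a field $K$, and let $\mathcal{C}(\mathbf{C},z)=\sum_{n\ge1}\frac{c_n(\mathbf{C})}{n!}z^n$ be its complexity function. Then (1) $\mathcal{C}(\mathbf{C},z)\preceq \frac{z^2}{2}\exp(z)+z-\frac{z^3}{6}$; (2) $\mathcal{C}(\mathbf{C},z)=\frac{z^2}{2}\exp(z)+z-\frac{z^3}{6}$ if $\operatorname{char}K=2$; (3) $\mathcal{C}(\mathbf{C},z)=\frac{z^2}{2}\exp(z)+2z-\sinh(z)$ if $\operatorname{char}K\ne 2$.
   Context: A Lie algebra is centre-by-metabelian if it satisfies the identity $[[[X_1,X_2],[X_3,X_4]],X_5]\equiv0$. For a variety $\mathbf{V}$ of Lie algebras over $K$, let $F(\mathbf{V},X)$ be its relatively free algebra on the countable set $X=\{x_i\mid i\in\mathbb{N}\}$. The codimension $c_n(\mathbf{V})$, $n\ge1$, is the dimension over $K$ of the subspace of $F(\mathbf{V},X)$ of multilinear polynomials of degree $n$ in $x_1,\dots,x_n$. For power series with real coefficients, $\sum a_nz^n\preceq\sum b_nz^n$ means $a_n\le b_n$ for all $n\ge0$. *)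

(* Defs.v *)
From HB Require Import structures.
From mathcomp Require Import all_boot all_order all_algebra generic_quotient.
From mathcomp Require Import mathcomp_extra boolp classical_sets functions
  cardinality reals.

Set Implicit Arguments.
Unset Strict Implicit.
Unset Printing Implicit Defensive.

Import GRing.Theory.
Local Open Scope ring_scope.
Local Open Scope classical_set_scope.
Local Open Scope quotient_scope.

HB.mixin Record Lmodule_isLieAlgebra (K : fieldType) L of GRing.Lmodule K L := {
  bracket : L -> L -> L;
  bracketDl : forall x y z, bracket (x + y) z = bracket x z + bracket y z;
  bracketDr : forall x y z, bracket x (y + z) = bracket x y + bracket x z;
  bracketZl : forall (a : K) x y, bracket (a *: x) y = a *: bracket x y;
  bracketZr : forall (a : K) x y, bracket x (a *: y) = a *: bracket x y;
  (* alternating, not merely skew-symmetric: K may have characteristic 2 *)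
  bracketxx : forall x, bracket x x = 0;
  jacobi : forall x y z,
    bracket (bracket x y) z + bracket (bracket y z) x
      + bracket (bracket z x) y = 0
}.

#[short(type="lieAlgType")]
HB.structure Definition LieAlgebra (K : fieldType) :=
  {L of Lmodule_isLieAlgebra K L & GRing.Lmodule K L}.

Definition lie_morphism (K : fieldType) (L L' : lieAlgType K) (f : L -> L') :=
  [/\ forall x y, f (x + y) = f x + f y,
      forall (a : K) x, f (a *: x) = a *: f x
    & forall x y, f (bracket x y) = bracket (f x) (f y)].

Section Dimension.
Variables (K : fieldType) (V : lmodType K).

Definition lin_span (S : set V) : set V :=
  [set v | exists m (s : 'I_m -> V) (a : 'I_m -> K),
     (forall i, S (s i)) /\ v = \sum_i a i *: s i].

Definition lin_free d (b : 'I_d -> V) :=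
  forall a : 'I_d -> K, \sum_i a i *: b i = 0 -> forall i, a i = 0.

Definition is_basis (U : set V) d (b : 'I_d -> V) :=
  lin_free b /\ lin_span (range b) = U.

(* The value is 0 when U has no finite basis; by [dimension_finite] below this
   does not happen for the subspaces whose dimension is used here. *)
Definition dimension (U : set V) : nat :=
  xget 0%N [set d | exists b : 'I_d -> V, is_basis U b].

Lemma lin_span_range m (b : 'I_m -> V) v :
  lin_span (range b) v <-> exists a : 'I_m -> K, v = \sum_i a i *: b i.
Proof.
split=> [[k [s [a [sb ->]]]]|[a ->]]; last first.
  by exists m, b, a; split => // i; exists i.
have /choice [f fE] : forall i, exists j, b j = s i.
  by move=> i; have [j _ <-] := sb i; exists j.
exists (fun j => \sum_(i | f i == j) a i).
rewrite (partition_big f predT) //=; apply: eq_bigr => j _.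
by rewrite scaler_suml; apply: eq_bigr => i /eqP <-; rewrite fE.
Qed.

Lemma lin_span_basis_le (U : set V) d e (b : 'I_d -> V) (c : 'I_e -> V) :
  is_basis U b -> is_basis U c -> (d <= e)%N.
Proof.
move=> [bf bU] [cf cU].
have /choice [A AE] i : exists a : 'I_e -> K, b i = \sum_j a j *: c j.
  by apply/lin_span_range; rewrite cU -bU; apply/lin_span_range;
     exists (fun j => (j == i)%:R); rewrite (bigD1 i) //= eqxx scale1r big1
       ?addr0 // => j /negPf ->; rewrite scale0r.
have /choice [B BE] j : exists a : 'I_d -> K, c j = \sum_i a i *: b i.
  by apply/lin_span_range; rewrite bU -cU; apply/lin_span_range;
     exists (fun i => (i == j)%:R); rewrite (bigD1 j) //= eqxx scale1r big1
       ?addr0 // => i /negPf ->; rewrite scale0r.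
apply: (@mulmx1_min _ _ _ (\matrix_(i, j) A i j) (\matrix_(j, i) B j i)).
apply/matrixP => i k; rewrite !mxE; apply/eqP; rewrite -subr_eq0; apply/eqP.
move: k; apply: bf; under eq_bigr do rewrite scalerBl.
rewrite sumrB [X in _ - X](_ : _ = b i); last first.
  rewrite (bigD1 i) //= eqxx scale1r big1 ?addr0 // => k /negPf ki.
  by rewrite eq_sym ki scale0r.
apply/eqP; rewrite subr_eq0; apply/eqP; rewrite [RHS]AE.
under [RHS]eq_bigr do rewrite BE scaler_sumr.
rewrite exchange_big /=; apply: eq_bigr => k _; rewrite scaler_suml.
by apply: eq_bigr => j _; rewrite !mxE scalerA.
Qed.

Lemma dimensionE (U : set V) d (b : 'I_d -> V) : is_basis U b -> dimension U = d.
Proof.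
move=> bU; rewrite /dimension; case: xgetP => [_ -> [c cU]|/(_ d) []].
- by apply/eqP; rewrite eqn_leq (lin_span_basis_le cU bU)
     (lin_span_basis_le bU cU).
- by exists b.
Qed.

Lemma dimension_finite (S : set V) : finite_set S ->
  exists b : 'I_(dimension (lin_span S)) -> V, is_basis (lin_span S) b.
Proof.
move=> /finite_seqP [s ->].
set U := lin_span _.
pose P m := `[< exists b : 'I_m -> V, lin_span (range b) = U >].
have Pex : exists m, P m.
  exists (size s); apply/asboolP; exists (fun i => tnth (in_tuple s) i).
  congr lin_span; apply/seteqP; split=> [_ [i _ <-]|x /= /(tnthP (in_tuple s)) [i ->]].
    exact: mem_tnth.
  by exists i.
have [d /asboolP [b bU] dmin] := ex_minnP Pex.
suff bf : lin_free b.
  by have bB : is_basis U b by []; rewrite (dimensionE bB); exists b.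
move=> a a0 i; apply/eqP/negP => /negP ai.
case: d b bU dmin a a0 i ai => [|d] b bU dmin a a0 i ai; first by case: i ai.
suff /dmin : P d by rewrite ltnn.
apply/asboolP; exists (b \o lift i); rewrite -bU; apply/seteqP; split=> v.
  move=> [m [t [c [tb ->]]]]; exists m, t, c; split=> // j.
  by have [k _ <-] := tb j; exists (lift i k).
move=> /lin_span_range [c ->]; apply/lin_span_range.
have bi : b i = \sum_j (- (a i)^-1 * a (lift i j)) *: b (lift i j).
  move: a0; rewrite (bigD1_ord i) //= => /eqP; rewrite addr_eq0 => /eqP.
  move=> /(congr1 ( *:%R (a i)^-1)); rewrite scalerA mulVf // scale1r => ->.
  rewrite scalerN -scaleNr scaler_sumr.
  by apply: eq_bigr => j _; rewrite scalerA.
exists (fun j => c i * (- (a i)^-1 * a (lift i j)) + c (lift i j)).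
rewrite (bigD1_ord i) //= bi scaler_sumr -big_split /=.
by apply: eq_bigr => j _; rewrite scalerDl scalerA.
Qed.

End Dimension.

(* Expressions in the variables X_0, X_1, ...; they represent Lie polynomials,
   equality of Lie polynomials being imposed only when passing to [relfree]. *)
Inductive lie_poly (K : fieldType) : Type :=
  | LVar of nat
  | LZero
  | LAdd of lie_poly K & lie_poly K
  | LScale of K & lie_poly K
  | LBracket of lie_poly K & lie_poly K.

Arguments LVar {K} _%_N.
Arguments LZero {K}.

HB.instance Definition _ (K : fieldType) := gen_eqMixin (lie_poly K).
HB.instance Definition _ (K : fieldType) := gen_choiceMixin (lie_poly K).

Fixpoint lie_eval (K : fieldType) (L : lieAlgType K) (v : nat -> L)
    (p : lie_poly K) : L :=
  match p with
  | LVar i => v i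
  | LZero => 0
  | LAdd p q => lie_eval v p + lie_eval v q
  | LScale a p => a *: lie_eval v p
  | LBracket p q => bracket (lie_eval v p) (lie_eval v q)
  end.

Definition satisfies (K : fieldType) (L : lieAlgType K) (p : lie_poly K) :=
  forall v : nat -> L, lie_eval v p = 0.

(* A variety is given by a set of defining identities p = 0. *)
Definition lie_variety (K : fieldType) := set (lie_poly K).

Definition in_variety (K : fieldType) (V : lie_variety K) (L : lieAlgType K) :=
  forall p, V p -> satisfies L p.

Definition centre_by_metabelian (K : fieldType) : lie_variety K :=
  [set LBracket
         (LBracket (LBracket (LVar 1) (LVar 2)) (LBracket (LVar 3) (LVar 4)))
         (LVar 5)].
Arguments centre_by_metabelian : clear implicits.

Section RelativelyFree.
Variables (K : fieldType) (V : lie_variety K).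

Definition variety_eq (p q : lie_poly K) : bool :=
  `[< forall L : lieAlgType K, in_variety V L ->
      forall v : nat -> L, lie_eval v p = lie_eval v q >].

Lemma variety_eq_equiv : equiv_class_of variety_eq.
Proof.
split=> [p|p q|q p r].
- exact/asboolP.
- by apply/asboolP/asboolP => pq L LV v; rewrite pq.
- by move=> /asboolP pq /asboolP qr; apply/asboolP => L LV v; rewrite pq ?qr.
Qed.

Canonical variety_equiv := EquivRelPack variety_eq_equiv.

Definition relfree := {eq_quot variety_equiv}.
HB.instance Definition _ := Choice.on relfree.
HB.instance Definition _ := EqQuotient.on relfree.

Implicit Types (x y z : relfree) (p q : lie_poly K) (a b : K).

Definition lie_class p : relfree := \pi_relfree p.
Definition relfree_zero := lie_class LZero.
Definition relfree_add x y := lie_class (LAdd (repr x) (repr y)).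
Definition relfree_scale a x := lie_class (LScale a (repr x)).
Definition relfree_opp := relfree_scale (-1).
Definition relfree_bracket x y := lie_class (LBracket (repr x) (repr y)).

Lemma lie_classP p q : lie_class p = lie_class q <->
  forall L : lieAlgType K, in_variety V L ->
    forall v : nat -> L, lie_eval v p = lie_eval v q.
Proof.
by split=> [/eqquotP /asboolP //|pq]; apply/eqquotP/asboolP.
Qed.

Let eval_repr p (L : lieAlgType K) (LV : in_variety V L) (v : nat -> L) :
  lie_eval v (repr (lie_class p)) = lie_eval v p.
Proof. by move: L LV v; apply/lie_classP; rewrite /lie_class reprK. Qed.

Let addE p q :
  relfree_add (lie_class p) (lie_class q) = lie_class (LAdd p q).
Proof. by apply/lie_classP => L LV v /=; rewrite !eval_repr. Qed.

Let scaleE a p : relfree_scale a (lie_class p) = lie_class (LScale a p).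
Proof. by apply/lie_classP => L LV v /=; rewrite !eval_repr. Qed.

Let bracketE p q :
  relfree_bracket (lie_class p) (lie_class q) = lie_class (LBracket p q).
Proof. by apply/lie_classP => L LV v /=; rewrite !eval_repr. Qed.

Let classE x : exists p, x = lie_class p.
Proof. by exists (repr x); rewrite /lie_class reprK. Qed.

Let relfree_addA : associative relfree_add.
Proof.
move=> x y z; have [[[p ->] [q ->]] [r ->]] := (classE x, classE y, classE z).
by rewrite !addE; apply/lie_classP => L LV v /=; rewrite addrA.
Qed.

Let relfree_addC : commutative relfree_add.
Proof.
move=> x y; have [[p ->] [q ->]] := (classE x, classE y).
by rewrite !addE; apply/lie_classP => L LV v /=; rewrite addrC.
Qed.

Let relfree_add0 : left_id relfree_zero relfree_add.
Proof.
move=> x; have [p ->] := classE x.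
by rewrite !addE; apply/lie_classP => L LV v /=; rewrite add0r.
Qed.

Let relfree_addN : left_inverse relfree_zero relfree_opp relfree_add.
Proof.
move=> x; have [p ->] := classE x; rewrite /relfree_opp scaleE addE.
by apply/lie_classP => L LV v /=; rewrite scaleN1r addNr.
Qed.

HB.instance Definition _ := GRing.isZmodule.Build relfree
  relfree_addA relfree_addC relfree_add0 relfree_addN.

Let relfree_scaleA a b x :
  relfree_scale a (relfree_scale b x) = relfree_scale (a * b) x.
Proof.
have [p ->] := classE x; rewrite !scaleE.
by apply/lie_classP => L LV v /=; rewrite scalerA.
Qed.

Let relfree_scale1 : left_id 1 relfree_scale.
Proof.
move=> x; have [p ->] := classE x; rewrite !scaleE.
by apply/lie_classP => L LV v /=; rewrite scale1r.
Qed.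

Let relfree_scaleDr : right_distributive relfree_scale +%R.
Proof.
move=> a x y; have [[p ->] [q ->]] := (classE x, classE y).
rewrite /+%R /= !(scaleE, addE).
by apply/lie_classP => L LV v /=; rewrite scalerDr.
Qed.

Let relfree_scaleDl x : {morph relfree_scale^~ x : a b / a + b}.
Proof.
move=> a b; have [p ->] := classE x.
rewrite [in RHS]/+%R /= !(scaleE, addE).
by apply/lie_classP => L LV v /=; rewrite scalerDl.
Qed.

HB.instance Definition _ := GRing.Zmodule_isLmodule.Build K relfree
  relfree_scaleA relfree_scale1 relfree_scaleDr relfree_scaleDl.

Let addE' p q : lie_class p + lie_class q = lie_class (LAdd p q).
Proof. exact: addE. Qed.

Let scaleE' a p : a *: lie_class p = lie_class (LScale a p).
Proof. exact: scaleE. Qed.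

Let relfree_bracketDl x y z : relfree_bracket (x + y) z =
  relfree_bracket x z + relfree_bracket y z.
Proof.
have [[[p ->] [q ->]] [r ->]] := (classE x, classE y, classE z).
rewrite !(addE', bracketE).
by apply/lie_classP => L LV v /=; rewrite bracketDl.
Qed.

Let relfree_bracketDr x y z : relfree_bracket x (y + z) =
  relfree_bracket x y + relfree_bracket x z.
Proof.
have [[[p ->] [q ->]] [r ->]] := (classE x, classE y, classE z).
rewrite !(addE', bracketE).
by apply/lie_classP => L LV v /=; rewrite bracketDr.
Qed.

Let relfree_bracketZl a x y :
  relfree_bracket (a *: x) y = a *: relfree_bracket x y.
Proof.
have [[p ->] [q ->]] := (classE x, classE y); rewrite !(scaleE', bracketE).
by apply/lie_classP => L LV v /=; rewrite bracketZl.
Qed.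

Let relfree_bracketZr a x y :
  relfree_bracket x (a *: y) = a *: relfree_bracket x y.
Proof.
have [[p ->] [q ->]] := (classE x, classE y); rewrite !(scaleE', bracketE).
by apply/lie_classP => L LV v /=; rewrite bracketZr.
Qed.

Let relfree_bracketxx x : relfree_bracket x x = 0.
Proof.
have [p ->] := classE x; rewrite bracketE.
by apply/lie_classP => L LV v /=; rewrite bracketxx.
Qed.

Let relfree_jacobi x y z :
  relfree_bracket (relfree_bracket x y) z
    + relfree_bracket (relfree_bracket y z) x
    + relfree_bracket (relfree_bracket z x) y = 0.
Proof.
have [[[p ->] [q ->]] [r ->]] := (classE x, classE y, classE z).
rewrite !(bracketE, addE').
by apply/lie_classP => L LV v /=; rewrite jacobi.
Qed.

HB.instance Definition _ := Lmodule_isLieAlgebra.Build K relfree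
  relfree_bracketDl relfree_bracketDr relfree_bracketZl relfree_bracketZr
  relfree_bracketxx relfree_jacobi.

Definition relfree_gen (i : nat) : relfree := lie_class (LVar i).

Lemma lie_class_eval p : lie_class p = lie_eval relfree_gen p.
Proof.
elim: p => [//|//|p IHp q IHq|a p IHp|p IHp q IHq] /=;
  rewrite -IHp -?IHq; symmetry; [exact: addE|exact: scaleE|exact: bracketE].
Qed.

Fixpoint lie_subst (s : nat -> lie_poly K) p : lie_poly K :=
  match p with
  | LVar i => s i
  | LZero => LZero
  | LAdd p q => LAdd (lie_subst s p) (lie_subst s q)
  | LScale a p => LScale a (lie_subst s p)
  | LBracket p q => LBracket (lie_subst s p) (lie_subst s q)
  end.

Lemma lie_eval_subst (L : lieAlgType K) (v : nat -> L) s p :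
  lie_eval v (lie_subst s p) = lie_eval (fun i => lie_eval v (s i)) p.
Proof. by elim: p => //= [p -> q ->|a p ->|p -> q ->]. Qed.

Lemma relfree_in_variety : in_variety V relfree.
Proof.
move=> p Vp w; have -> : w = fun i => lie_eval relfree_gen (repr (w i)).
  by apply/funext => i; rewrite -lie_class_eval /lie_class reprK.
rewrite -lie_eval_subst -lie_class_eval; apply/lie_classP => L LV v.
by rewrite lie_eval_subst /=; apply: LV.
Qed.

Lemma lie_morphism_eval (L L' : lieAlgType K) (f : L -> L') (v : nat -> L) p :
  lie_morphism f -> f (lie_eval v p) = lie_eval (f \o v) p.
Proof.
move=> [fD fZ fB]; elim: p => //= [|p IHp q IHq|a p IHp|p IHp q IHq].
- by rewrite -(scale0r 0) fZ scale0r.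
- by rewrite fD IHp IHq.
- by rewrite fZ IHp.
- by rewrite fB IHp IHq.
Qed.

Lemma relfree_universal (L : lieAlgType K) (v : nat -> L) : in_variety V L ->
  exists! f : relfree -> L,
    lie_morphism f /\ forall i, f (relfree_gen i) = v i.
Proof.
move=> LV; exists (fun x => lie_eval v (repr x)); split.
  by split=> [|i]; [split=> *|]; rewrite eval_repr.
move=> g [gm gv]; apply/funext => x; have [p ->] := classE x.
rewrite eval_repr // lie_class_eval (lie_morphism_eval _ _ gm).
by congr lie_eval; apply/funext => i; rewrite /= gv.
Qed.

End RelativelyFree.

(* Nonassociative monomials in the variables X_0, X_1, ... *)
Inductive lie_monomial : Type :=
  | MVar of nat
  | MBracket of lie_monomial & lie_monomial.

HB.instance Definition _ := gen_eqMixin lie_monomial.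
HB.instance Definition _ := gen_choiceMixin lie_monomial.

Fixpoint monomial_eval (K : fieldType) (L : lieAlgType K) (v : nat -> L)
    (m : lie_monomial) : L :=
  match m with
  | MVar i => v i
  | MBracket m m' => bracket (monomial_eval v m) (monomial_eval v m')
  end.

Fixpoint letters (m : lie_monomial) : seq nat :=
  match m with
  | MVar i => [:: i]
  | MBracket m m' => letters m ++ letters m'
  end.

(* monomials in which each of X_1, ..., X_n, and no other variable,
   occurs exactly once *)
Definition multilinear_monomial (n : nat) : set lie_monomial :=
  [set m | perm_eq (letters m) (iota 1 n)].

Definition multilinear (K : fieldType) (V : lie_variety K) (n : nat) :
    set (relfree V) :=
  lin_span (monomial_eval (@relfree_gen K V) @` multilinear_monomial n).

Arguments multilinear [K] V n%_N _.

Definition codimension (K : fieldType) (V : lie_variety K) (n : nat) : nat :=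
  dimension (multilinear V n).

Lemma finite_multilinear_monomial n : finite_set (multilinear_monomial n).
Proof.
pose E k := [set m | (size (letters m) <= k)%N /\
                     {subset letters m <= iota 1 n}].
have size_gt0 m : (0 < size (letters m))%N.
  by elim: m => //= m Hm m' _; rewrite size_cat addn_gt0 Hm.
suff finE k : finite_set (E k).
  apply: sub_finite_set (finE n) => m /= mn; split.
    by rewrite (perm_size mn) size_iota.
  by move=> i; rewrite (perm_mem mn).
elim: k => [|k IHk].
  by apply: (@sub_finite_set _ _ set0) => // m [] /=; rewrite leqNgt size_gt0.
apply: (@sub_finite_set _ _
  ((MVar @` [set` iota 1 n]) `|`
   ((fun mm => MBracket mm.1 mm.2) @` (E k `*` E k)))).
  move=> [i|m m'] [/= sk lk]; [left|right].
    by exists i => //=; apply: lk; rewrite inE.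
  exists (m, m') => //; move: sk; rewrite size_cat => sk.
  have [m0 m'0] := (size_gt0 m, size_gt0 m').
  split; split=> /=.
  - by rewrite -ltnS (leq_trans _ sk) // -addn1 leq_add2l.
  - by move=> i im; apply: lk; rewrite mem_cat im.
  - by rewrite -ltnS (leq_trans _ sk) // -add1n leq_add2r.
  - by move=> i im; apply: lk; rewrite mem_cat im orbT.
rewrite finite_setU; split; apply: finite_image; first exact: finite_seq.
exact: finite_setX.
Qed.

Lemma codimensionP (K : fieldType) (V : lie_variety K) n :
  exists b : 'I_(codimension V n) -> relfree V, is_basis (multilinear V n) b.
Proof.
exact/dimension_finite/finite_image/finite_multilinear_monomial.
Qed.

(* A formal power series is its sequence of coefficients nat -> R, with the
   pointwise addition and opposite of functions; the library's product of
   functions is pointwise, hence [series_mul]. *)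
Section PowerSeries.
Variable R : realType.
Implicit Types f g : nat -> R.

Definition series_mul f g : nat -> R :=
  fun n => \sum_(i < n.+1) f i * g (n - i)%N.

Definition series_scale (a : R) f : nat -> R := fun n => a * f n.

Definition series_le f g := forall n, f n <= g n.

Definition zpow k : nat -> R := fun n => (n == k)%:R.

Definition series_exp : nat -> R := fun n => (n`!%:R)^-1.

(* exp (- z) *)
Definition series_expN : nat -> R := fun n => (-1) ^+ n * series_exp n.

Definition series_sinh : nat -> R :=
  series_scale 2^-1 (series_exp - series_expN).

Definition complexity (K : fieldType) (V : lie_variety K) : nat -> R :=
  fun n => if (0 < n)%N then (codimension V n)%:R / n`!%:R else 0.

End PowerSeries.

Arguments zpow {R} (k _)%_N.
Arguments series_exp {R} _%_N.
Arguments series_sinh {R} _%_N.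
Arguments complexity R [K] V _%_N.

(* Main.v *)
Require Import Defs.
From HB Require Import structures.
From mathcomp Require Import all_boot all_order all_algebra.
From mathcomp Require Import mathcomp_extra boolp classical_sets functions
  cardinality reals.
From mathcomp Require Import zify ring.
Set Implicit Arguments.
Unset Strict Implicit.
Unset Printing Implicit Defensive.

Import GRing.Theory.
Local Open Scope ring_scope.

(** Let L be the relatively free algebra, with generators x_1, x_2, ... The identity
says that L'' = [L', L'] is central. Hence the operators ad x_i commute on L' up to
central elements, and [[u, x_i], v] = - [u, [v, x_i]] for u and v in L'
([derived_move]).

The upper bound. The multilinear elements of degree n >= 2 are spanned by
the left-normed brackets [x_i, x_j, x_c, ..., x_d]. Modulo L'' the letters after the
first two can be permuted, and the Jacobi identity leaves the n - 1 elements
[x_j, x_1, ...]. What lies in L'' is spanned by the double brackets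
w(ij|kl) = [[x_i, x_j, ...], [x_k, x_l]], where the dots stand for all other letters in
any order. They are skew in i, j and in k, l, they satisfy
w(kl|ij) = (-1)^(n+1) w(ij|kl) ([dbracket_swap]), and for n >= 5 the cyclic sum of
w(ij|kl) over i, j, m is 0 ([dbracket_jacobi]). From these linear relations one gets
([W_in]) that all double brackets are combinations of the w(12|3k) with k >= 4, the
w(1i|2k) with 3 <= i < k, and w(14|23). For n odd and n >= 5 they also put 2 w(14|23)
into the span of the other ones ([Y_43_odd]), so that w(14|23) can be dropped unless
char K = 2. The spanning elements are labelled by the pairs i < j in {1, ..., n}:
(1, j) for [x_j, x_1, ...], (2, k) for w(12|3k), (i, k) for w(1i|2k), and (2, 3) for
w(14|23). This gives C(n, 2) elements, less one if n = 3 (where there are no double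
brackets) or if n is odd and char K is not 2.

The lower bound. Let S be the algebra of square-free polynomials in t_1, ..., t_n, with
t_i^2 = 0, let M be the S-module generated by m_1, ..., m_n with the relations
m_i t_i = 0, and let D_c be multiplication by t_c on M. For a bilinear form on M for which the D_c are skew-adjoint, let them act by
derivations on the Heisenberg algebra M + K. Then x_c |-> D_c + m_c sends [x_i, x_j]
to m_i t_j - m_j t_i up to a central term, which separates the elements
[x_j, x_1, ...] modulo L''. If the form is built from a matrix G ([form_at]), then w(ij|kl)
has the value G_ik - G_il - G_jk + G_jl ([eval_dbracket]). The form has to be
alternating only on the subalgebra generated by the D_c + m_c, whose elements
have coordinate sums equal to 0 in degree at least 2 ([balanced]). So it is enough that
G_ik + (-1)^n G_ki be a constant lam for i <> k. The matrices with lam = 0 separate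
the double brackets except for one dimension in some cases; for example, in
characteristic 2 they all vanish on w(12|34) + w(13|24) + w(14|23). If n is even or
char K = 2, then lam = 1 is possible with G_ik = [k < i]; modulo 2 this tells whether the
chords ij and kl cross, and it completes the proof of independence
([dependence_crossing]). *)

(** * Subspaces and dimension *)

Section Span.
Variables (K : fieldType) (V : lmodType K).
Implicit Types (S : set V) (u v : V).

Definition submodule (U : set V) :=
  [/\ U 0, forall u v, U u -> U v -> U (u + v)
    & forall (a : K) u, U u -> U (a *: u)].

Lemma submoduleN U u : submodule U -> U u -> U (- u).
Proof. by move=> [_ _ UZ] Uu; rewrite -scaleN1r; apply: UZ. Qed.

Lemma submoduleB U u v : submodule U -> U u -> U v -> U (u - v).
Proof.
by move=> sU Uu Uv; case: (sU) => _ UD _; apply: UD => //; exact: submoduleN.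
Qed.

Lemma submodule_sum U m (s : 'I_m -> V) (a : 'I_m -> K) :
  submodule U -> (forall i, U (s i)) -> U (\sum_i a i *: s i).
Proof.
move=> [U0 UD UZ] Us; elim/big_ind: _ => // i _; exact: UZ.
Qed.

Lemma submodule_lin_span S : submodule (lin_span S).
Proof.
split.
- exists 0, (fun _ => 0), (fun _ => 0); split=> [[]//|]; by rewrite big_ord0.
- move=> u v [m [s [a [Ss ->]]]] [m' [s' [a' [Ss' ->]]]].
  exists (m + m')%N,
    (fun i => match fintype.split i with inl j => s j | inr j => s' j end),
    (fun i => match fintype.split i with inl j => a j | inr j => a' j end).
  split=> [i|]; first by case: (fintype.split i).
  by rewrite big_split_ord /=; congr (_ + _); apply: eq_bigr => i _;
    [rewrite (unsplitK (inl i))|rewrite (unsplitK (inr i))].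
- move=> b u [m [s [a [Ss ->]]]]; exists m, s, (fun i => b * a i); split=> //.
  by rewrite scaler_sumr; apply: eq_bigr => i _; rewrite scalerA.
Qed.

Lemma lin_span_gen S u : S u -> lin_span S u.
Proof.
by move=> Su; exists 1, (fun _ => u), (fun _ => 1); split=> //;
  rewrite big_ord1 scale1r.
Qed.

Lemma lin_span_sub S U : submodule U -> (forall u, S u -> U u) ->
  forall u, lin_span S u -> U u.
Proof.
by move=> sU SU _ [m [s [a [Ss ->]]]]; apply: submodule_sum => // i; apply: SU.
Qed.

Lemma dimension_finType (T : finType) (b : T -> V) (U : set V) :
  (forall a : T -> K, \sum_t a t *: b t = 0 -> forall t, a t = 0) ->
  lin_span (range b) = U -> dimension U = #|T|.
Proof.
move=> bf bU; apply: (@dimensionE _ _ _ _ (b \o enum_val)); split.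
- move=> a a0 i; rewrite -(enum_valK i).
  apply: (bf (a \o enum_rank)); rewrite -[RHS]a0.
  rewrite (reindex_onto enum_val enum_rank) /=; last by move=> t _; exact: enum_rankK.
  by apply: eq_big => [j|j _]; rewrite enum_valK ?eqxx.
- rewrite -bU; congr lin_span; apply/seteqP; split=> _ [i _ <-].
    by exists (enum_val i).
  by exists (enum_rank i) => //=; rewrite enum_rankK.
Qed.

End Span.

(** Adjacent transpositions generate all permutations; this is how commutation
   of neighbouring letters becomes independence of their order. *)
Lemma perm_eq_adjacent_ind (T : eqType) (R : seq T -> seq T -> Prop) :
  (forall s, R s s) -> (forall t s u, R s t -> R t u -> R s u) ->
  (forall s1 a b s2, R (s1 ++ a :: b :: s2) (s1 ++ b :: a :: s2)) ->
  forall s t, perm_eq s t -> R s t.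
Proof.
move=> Rxx Rtr Rsw s t st; rewrite -[s]cat0s -[t]cat0s; move: [::] => p.
elim: s t p st => [|a s IHs] t p st.
  by move: (perm_size st); case: t st.
have : a \in t by rewrite -(perm_mem st) mem_head.
move=> at_; case/splitPr: at_ st => t1 t2.
rewrite perm_sym perm_catC /= perm_cons perm_catC perm_sym => st.
apply: (Rtr (p ++ a :: t1 ++ t2)).
  by have := IHs (t1 ++ t2) (p ++ [:: a]) st; rewrite -!catA.
elim: t1 p {st IHs} => [|b t1 IHt] p //=.
apply: Rtr (Rsw p a b (t1 ++ t2)) _.
by have := IHt (p ++ [:: b]); rewrite -!catA.
Qed.

(** * Consequences of the relations between double brackets *)

Section Combinatorics.
Variables (K : fieldType) (V : lmodType K) (U : set V) (n : nat).
Variable W : nat -> nat -> nat -> nat -> V.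
Hypothesis sU : submodule U.

Definition letter i := (0 < i <= n)%N.

Hypothesis WCl : forall i j k l, W j i k l = - W i j k l.
Hypothesis WCr : forall i j k l, W i j l k = - W i j k l.
Hypothesis Wswap : forall i j k l, uniq [:: i; j; k; l] ->
  all letter [:: i; j; k; l] -> W k l i j = (-1) ^+ n.+1 *: W i j k l.
Hypothesis Wjac : forall i j m k l, uniq [:: i; j; m; k; l] ->
  all letter [:: i; j; m; k; l] -> W i j k l + W j m k l + W m i k l = 0.

Ltac letters :=
  repeat match goal with H : is_true _ |- _ => move: H end;
  rewrite /letter /= ?inE; lia.

Lemma submodule_eq u v : U (u - v) -> U v -> U u.
Proof. by case: sU => _ UD _ Uuv Uv; rewrite -(subrK v u); apply: UD. Qed.

Lemma W_left i j m k l : uniq [:: i; j; m; k; l] ->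
  all letter [:: i; j; m; k; l] -> W i j k l = W m j k l - W m i k l.
Proof.
move=> u a; move: (Wjac u a) => /eqP; rewrite -addrA addr_eq0 => /eqP ->.
by rewrite (WCl m j) opprD opprK.
Qed.

(** Swapping the two pairs turns the cyclic relation for the first pair into one
   for the second pair; the three signs agree. *)
Lemma W_right i j m k l : uniq [:: i; j; m; k; l] ->
  all letter [:: i; j; m; k; l] -> W i j k l = W i j m l - W i j m k.
Proof.
move=> u a; rewrite (Wswap (i := k) (j := l)); [|letters..].
rewrite (Wswap (i := m) (j := l)); [|letters..].
rewrite (Wswap (i := m) (j := k)); [|letters..].
by rewrite -scalerBr; congr (_ *: _); apply: W_left; letters.
Qed.

Let Y i k := W 1 i 2 k.

Hypothesis W123_in : forall k, (3 < k <= n)%N -> U (W 1 2 3 k).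
Hypothesis Y_lt_in : forall i k, (2 < i < k)%N -> (k <= n)%N -> U (Y i k).

Lemma W12_in k l : uniq [:: 1%N; 2%N; k; l] -> all letter [:: k; l] ->
  U (W 1 2 k l).
Proof.
move=> u a; have [k3|k3] := eqVneq k 3%N; first by rewrite k3; apply: W123_in; letters.
have [l3|l3] := eqVneq l 3.
  by rewrite l3 WCr; apply: (submoduleN sU); apply: W123_in; letters.
rewrite (@W_right 1 2 3 k l)%N; [|letters..].
by apply: submoduleB => //; apply: W123_in; letters.
Qed.

(** The only relation left between the Y i k: expand W i 2 k l and W k l i 2
   with the letter 1 as a reference point and compare them by Wswap. *)
Lemma Y_key i k l : uniq [:: 1%N; 2%N; i; k; l] -> all letter [:: i; k; l] ->
  U ((Y k i - Y l i) + (-1) ^+ n.+1 *: (Y i l - Y i k)).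
Proof.
move=> u a; case: (sU) => _ _ UZ.
have e : Y k i - Y l i = W k l i 2.
  by rewrite (@W_left k l 1 i 2)%N; [rewrite !(WCr _ _ 2 i) opprK addrC|letters..].
rewrite e (@Wswap i 2 k l)%N; [|letters..].
rewrite (@W_left i 2 1 k l)%N; [|letters..].
rewrite (@W_right 1 i 2 k l)%N; [|letters..].
by rewrite -scalerDr subrK; apply: UZ; apply: W12_in; letters.
Qed.

Lemma Y_max i k l : uniq [:: i; k; l] -> (2 < k < i)%N -> (2 < l < i)%N ->
  (i <= n)%N -> U (Y i k) -> U (Y i l).
Proof.
move=> u k2 l2 ni Uik; case: (sU) => _ _ UZ.
apply: (submodule_eq (v := Y i k)) => //.
rewrite -[_ - _](signrZK n.+1); apply: UZ.
apply: (submodule_eq (v := - (Y k i - Y l i))); last first.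
  by apply: submoduleN => //; apply: submoduleB => //; apply: Y_lt_in; lia.
by rewrite opprK addrC; apply: Y_key; letters.
Qed.

Lemma Y_min i k l : uniq [:: i; k; l] -> (2 < i < k)%N -> (2 < i < l)%N ->
  (k <= n)%N -> (l <= n)%N -> U (Y k i) -> U (Y l i).
Proof.
move=> u k2 l2 nk nl Uki; case: (sU) => _ UD UZ.
rewrite -[Y l i]opprK; apply: submoduleN => //.
apply: (submodule_eq (v := - Y k i)); last exact: submoduleN.
rewrite opprK addrC.
apply: (submodule_eq (v := - ((-1) ^+ n.+1 *: (Y i l - Y i k)))); last first.
  apply: submoduleN => //; apply: UZ; apply: submoduleB => //; apply: Y_lt_in; lia.
by rewrite opprK; apply: Y_key; letters.
Qed.

(** For n odd the sign in [Y_key] is +, and its instances on the letters 3, 4, 5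
   read Y 5 4 = Y 5 3 = Y 4 3 = - Y 5 4 modulo U. *)
Lemma Y_43_odd : odd n -> (4 < n)%N -> 2 != 0 :> K -> U (Y 4 3).
Proof.
move=> on n4 K2; case: (sU) => _ UD UZ.
(* each time the remaining terms Y i k with i < k are in U *)
have U54 : U (Y 5 4 - Y 5 3).
  apply: (submodule_eq (v := Y 4 5 - Y 3 5)).
    rewrite addrC opprB; have := (@Y_key 5 3 4)%N; rewrite exprS -signr_odd on.
    by rewrite mulrNN mulr1 scale1r; apply; letters.
  by apply: submoduleB => //; apply: Y_lt_in; lia.
have U53 : U (Y 4 3 - Y 5 3).
  apply: (submodule_eq (v := - (Y 3 5 - Y 3 4))).
    rewrite opprK; have := (@Y_key 3 4 5)%N; rewrite exprS -signr_odd on.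
    by rewrite mulrNN mulr1 scale1r; apply; letters.
  by apply: submoduleN => //; apply: submoduleB => //; apply: Y_lt_in; lia.
have U4354 : U (Y 4 3 + Y 5 4).
  apply: (submodule_eq (v := Y 3 4 + Y 4 5)).
    rewrite -[_ - _]opprB; apply: submoduleN => //.
    have := (@Y_key 4 3 5)%N; rewrite exprS -signr_odd on mulrNN mulr1 scale1r.
    by rewrite opprD addrACA [- Y 4 3 - _]addrC addrACA; apply; letters.
  by apply: UD; apply: Y_lt_in; lia.
have U2 : U (2 *: Y 4 3).
  have -> : 2 *: Y 4 3 = (Y 4 3 - Y 5 3) - (Y 5 4 - Y 5 3) + (Y 4 3 + Y 5 4).
    by rewrite opprB subrKA addrACA addNr addr0 scaler_nat mulr2n.
  by apply: UD => //; apply: submoduleB.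
by rewrite -[Y 4 3]scale1r -(mulVf K2) -scalerA; apply: UZ.
Qed.

Hypothesis W1423_in : ~~ (odd n && (2 != 0 :> K)) -> U (W 1 4 2 3).

Lemma Y_in (i k : nat) : uniq [:: 1%N; 2%N; i; k] -> all letter [:: i; k] ->
  U (Y i k).
Proof.
move=> u a; have [ik|ki] := ltnP i k; first by apply: Y_lt_in; letters.
have U43 : U (Y 4 3).
  have [/andP[on K2]|] := boolP (odd n && (2 != 0 :> K)); last exact: W1423_in.
  by apply: Y_43_odd => //; letters.
have Ui3 : (3 < i)%N -> U (Y i 3).
  move=> i3; have [->//|i4] := eqVneq i 4.
  by apply: (@Y_min 3 4 i)%N => //; letters.
have [->|k3] := eqVneq k 3%N; first by apply: Ui3; letters.
by apply: (@Y_max i 3 k)%N; [letters..|apply: Ui3; letters].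
Qed.

Lemma W1_in i k l : uniq [:: 1%N; i; k; l] -> all letter [:: i; k; l] ->
  U (W 1 i k l).
Proof.
move=> u a; have [i2|i2] := eqVneq i 2%N; first by rewrite i2; apply: W12_in; letters.
have [k2|k2] := eqVneq k 2%N; first by rewrite k2; apply: Y_in; letters.
have [l2|l2] := eqVneq l 2.
  by rewrite l2 WCr; apply: submoduleN => //; apply: Y_in; letters.
rewrite (@W_right 1 i 2 k l)%N; [|letters..].
by apply: submoduleB => //; apply: Y_in; letters.
Qed.

(** All double brackets follow from the W 1 2 3 k, the Y i k with i < k, and
   W 1 4 2 3; the letter 1 is brought in by the cyclic relation. *)
Lemma W_in i j k l : uniq [:: i; j; k; l] -> all letter [:: i; j; k; l] ->
  U (W i j k l).
Proof.
case: (sU) => _ _ UZ.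
have base i' j' k' l' : uniq [:: i'; j'; k'; l'] ->
    all letter [:: i'; j'; k'; l'] -> 1%N \notin [:: k'; l'] -> U (W i' j' k' l').
  move=> u a; rewrite !inE => kl.
  have [i1|i1] := eqVneq i' 1%N; first by rewrite i1; apply: W1_in; letters.
  have [j1|j1] := eqVneq j' 1.
    by rewrite j1 WCl; apply: submoduleN => //; apply: W1_in; letters.
  rewrite (@W_left i' j' 1 k' l')%N; [|letters..].
  by apply: submoduleB => //; apply: W1_in; letters.
move=> u a; have [kl|] := boolP (1%N \in [:: k; l]); last exact: base.
by rewrite (@Wswap k l i j)%N; [apply: UZ; apply: base|..]; letters.
Qed.

End Combinatorics.

(** * Left-normed brackets *)

Section Bracket.
Variables (K : fieldType) (L : lieAlgType K).
Implicit Types u v w y : L.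

Lemma bracket0l u : bracket 0 u = 0.
Proof. by apply: (addrI (bracket 0 u)); rewrite -bracketDl !addr0. Qed.

Lemma bracketNl u v : bracket (- u) v = - bracket u v.
Proof. by rewrite -scaleN1r bracketZl scaleN1r. Qed.

Lemma bracketNr u v : bracket u (- v) = - bracket u v.
Proof. by rewrite -scaleN1r bracketZr scaleN1r. Qed.

Lemma bracketC u v : bracket u v = - bracket v u.
Proof.
apply/eqP; rewrite -addr_eq0; have /eqP := bracketxx (u + v).
by rewrite bracketDl !bracketDr !bracketxx add0r addr0.
Qed.

Lemma bracket_deriv u v w :
  bracket (bracket u v) w = bracket (bracket u w) v + bracket u (bracket v w).
Proof.
have /eqP := jacobi u v w; rewrite -addrA addr_eq0 opprD => /eqP ->.
by rewrite -(bracketC u) -(bracketNl _ v) -(bracketC u w) addrC.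
Qed.

End Bracket.

Section LeftNormed.
Variables (K : fieldType) (L : lieAlgType K) (x : nat -> L).
Implicit Types (u v w y : L) (s t : seq nat).

Definition lnormed u s := foldl (fun u c => bracket u (x c)) u s.

Lemma lnormed_cat u s t : lnormed u (s ++ t) = lnormed (lnormed u s) t.
Proof. exact: foldl_cat. Qed.

Lemma lnormed_rcons u s c : lnormed u (rcons s c) = bracket (lnormed u s) (x c).
Proof. by rewrite -cats1 lnormed_cat. Qed.

Lemma lnormed_cons u c s : lnormed u (c :: s) = lnormed (bracket u (x c)) s.
Proof. by []. Qed.

Lemma lnormed0 s : lnormed 0 s = 0.
Proof. by elim: s => //= c s; rewrite /lnormed /= bracket0l. Qed.

Lemma lnormedD u v s : lnormed (u + v) s = lnormed u s + lnormed v s.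
Proof.
by elim: s u v => //= c s IHs u v; rewrite /lnormed /= bracketDl; exact: IHs.
Qed.

Lemma lnormedN u s : lnormed (- u) s = - lnormed u s.
Proof.
by elim: s u => //= c s IHs u; rewrite /lnormed /= bracketNl; exact: IHs.
Qed.

(** Induction on m, by [u, [v, w]] = [[u, v], w] - [[u, w], v]; stated for an
   arbitrary subspace U so that the induction can be applied to a preimage of U. *)
Lemma monomial_bracket_left_normed (U : set L) m u t : submodule U ->
  (forall s, perm_eq s (letters m) -> U (lnormed u (t ++ s))) ->
  U (bracket (lnormed u t) (monomial_eval x m)).
Proof.
elim: m U u t => [c|m1 IH1 m2 IH2] U u t sU Us /=.
  by rewrite -lnormed_rcons -cats1; apply: Us.
case: (sU) => U0 UD UZ; have sub m : submodule (fun v => U (bracket v m)).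
  split=> [|v w|a v]; rewrite ?bracket0l ?bracketDl ?bracketZl //.
    exact: UD.
  exact: UZ.
have -> : bracket (lnormed u t) (bracket (monomial_eval x m1) (monomial_eval x m2))
  = bracket (bracket (lnormed u t) (monomial_eval x m1)) (monomial_eval x m2)
    - bracket (bracket (lnormed u t) (monomial_eval x m2)) (monomial_eval x m1).
  by rewrite bracket_deriv addrC addKr.
apply: submoduleB => //.
  apply: (IH1 _ _ _ (sub _)) => s1 ps1; apply: IH2 => // s2 ps2.
  by rewrite -catA; apply: Us; apply: perm_cat.
apply: (IH2 _ _ _ (sub _)) => s2 ps2; apply: IH1 => // s1 ps1.
by rewrite -catA; apply: Us; rewrite perm_catC; apply: perm_cat.
Qed.

Lemma monomial_left_normed (U : set L) m : submodule U ->
  (forall i s, perm_eq (i :: s) (letters m) -> U (lnormed (x i) s)) ->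
  U (monomial_eval x m).
Proof.
elim: m U => [c|m1 IH1 m2 IH2] U sU Us /=; first by apply: (Us c [::]).
case: (sU) => U0 UD UZ.
have sub m : submodule (fun v => U (bracket v m)).
  split=> [|v w|a v]; rewrite ?bracket0l ?bracketDl ?bracketZl //.
    exact: UD.
  exact: UZ.
apply: (IH1 _ (sub _)) => i s ps.
apply: monomial_bracket_left_normed => // t pt.
by apply: Us; rewrite -cat_cons; apply: perm_cat.
Qed.

End LeftNormed.

(** * A spanning set of the multilinear part *)

Section CentreByMetabelian.
Variables (K : fieldType) (L : lieAlgType K) (x : nat -> L).
Implicit Types (u v w y : L) (s t : seq nat).

Hypothesis L_cbm : forall a b c d e : L,
  bracket (bracket (bracket a b) (bracket c d)) e = 0.

Let derived u := exists a b, u = bracket a b.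

Lemma derived_lnormed u s : derived u -> derived (lnormed x u s).
Proof.
by elim: s u => // c s IHs u _; apply: IHs; exists u, (x c).
Qed.

Lemma derived_bracket_central u v y : derived u -> derived v ->
  bracket (bracket u v) y = 0.
Proof. by move=> [a [b ->]] [c [d ->]]. Qed.

(** The sum of the two sides is [[u, v], w], which vanishes because [u, v] lies
   in the second derived algebra. *)
Lemma derived_move u v w : derived u -> derived v ->
  bracket (bracket u w) v = - bracket u (bracket v w).
Proof.
move=> du dv; apply/eqP; rewrite -addr_eq0 -bracket_deriv.
exact/eqP/derived_bracket_central.
Qed.

Lemma lnormed_adjacent u s1 a b s2 :
  lnormed x u (s1 ++ a :: b :: s2) = lnormed x u (s1 ++ b :: a :: s2)
    + lnormed x (bracket (lnormed x u s1) (bracket (x a) (x b))) s2.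
Proof. by rewrite !lnormed_cat !lnormed_cons -lnormedD -bracket_deriv. Qed.

(** Exchanging two neighbouring letters changes the element by a commutator of
   two elements of the derived algebra, which is central. *)
Lemma lnormed_perm u s t y : derived u -> perm_eq s t ->
  bracket (lnormed x u s) y = bracket (lnormed x u t) y.
Proof.
move=> du; move: s t; apply: perm_eq_adjacent_ind => [//|s t v -> //|s1 a b s2].
rewrite lnormed_adjacent bracketDl -[RHS]addr0; congr (_ + _).
have cen z : bracket (bracket (lnormed x u s1) (bracket (x a) (x b))) z = 0.
  by apply: derived_bracket_central; [apply: derived_lnormed|exists (x a), (x b)].
by case: s2 => [|c s2]; rewrite /lnormed /= cen // -/(lnormed x 0 s2) lnormed0 bracket0l.
Qed.

(** Iterating [derived_move] carries the letters of s over to the other factor, in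
   reverse order and with one sign each. *)
Lemma lnormed_transfer u v s : derived u -> derived v ->
  bracket (lnormed x u s) v = (-1) ^+ size s *: bracket u (lnormed x v (rev s)).
Proof.
move=> du; elim/last_ind: s v => [|s c IHs] v dv; first by rewrite scale1r.
rewrite lnormed_rcons derived_move //; last exact: derived_lnormed.
rewrite IHs; last by exists v, (x c).
by rewrite rev_rcons size_rcons exprS mulN1r scaleNr.
Qed.

Variable n : nat.

Definition rest s := [seq i <- iota 1 n | i \notin s].

Lemma mem_iota1 i : (i \in iota 1 n) = letter n i.
Proof. by rewrite mem_iota add1n ltnS. Qed.

Lemma perm_rest s : uniq s -> all (letter n) s ->
  perm_eq (s ++ rest s) (iota 1 n).
Proof.
move=> us /allP ls.
have /permPl := perm_filterC (mem s) (iota 1 n); apply: perm_trans.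
rewrite perm_cat2r; apply: uniq_perm => // [|i].
  by rewrite filter_uniq ?iota_uniq.
by rewrite mem_filter mem_iota1 andb_idr // => /ls.
Qed.

Lemma perm_restP s t : perm_eq (s ++ t) (iota 1 n) ->
  [/\ uniq s, all (letter n) s & perm_eq t (rest s)].
Proof.
move=> p; have u : uniq (s ++ t) by rewrite (perm_uniq p) iota_uniq.
have us : uniq s by move: u; rewrite cat_uniq => /andP[].
have ls : all (letter n) s.
  by apply/allP => i si; rewrite -mem_iota1 -(perm_mem p) mem_cat si.
by split=> //; rewrite -(perm_cat2l s) (perm_trans p) // perm_sym perm_rest.
Qed.

Lemma eq_rest s t : s =i t -> rest s = rest t.
Proof. by move=> st; apply: eq_filter => i; rewrite st. Qed.

Definition dbracket i j k l :=
  bracket (lnormed x (bracket (x i) (x j)) (rest [:: i; j; k; l]))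
    (bracket (x k) (x l)).

(** By [lnormed_perm], only the set of letters between the two pairs matters. *)
Lemma dbracketE i j k l s : perm_eq ([:: i; j; k; l] ++ s) (iota 1 n) ->
  bracket (lnormed x (bracket (x i) (x j)) s) (bracket (x k) (x l)) = dbracket i j k l.
Proof.
move=> /perm_restP[_ _ ps]; apply: lnormed_perm => //; by exists (x i), (x j).
Qed.

Lemma dbracket_Cl i j k l : dbracket j i k l = - dbracket i j k l.
Proof.
rewrite /dbracket (bracketC (x j)) lnormedN bracketNl; congr (- bracket (lnormed x _ _) _).
by apply: eq_rest => z; rewrite !inE orbCA.
Qed.

Lemma dbracket_Cr i j k l : dbracket i j l k = - dbracket i j k l.
Proof.
rewrite /dbracket (bracketC (x l)) bracketNr; congr (- bracket (lnormed x _ _) _).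
by apply: eq_rest => z; rewrite !inE; do 2!congr (_ || _); rewrite orbC.
Qed.

(** Carry the n - 4 remaining letters over to the other pair ([lnormed_transfer]);
   skew-symmetry of the outer bracket gives one more sign. *)
Lemma dbracket_swap i j k l : uniq [:: i; j; k; l] ->
  all (letter n) [:: i; j; k; l] -> dbracket k l i j = (-1) ^+ n.+1 *: dbracket i j k l.
Proof.
move=> u a; have p := perm_rest u a.
have sz : n = (size (rest [:: i; j; k; l])).+4.
  by rewrite -[LHS](size_iota 1) -(perm_size p).
rewrite {2}/dbracket lnormed_transfer; [|by exists (x i), (x j)|by exists (x k), (x l)].
rewrite [in RHS]bracketC dbracketE; last first.
  apply: perm_trans p; rewrite -[[:: i; j; k; l]]/([:: i; j] ++ [:: k; l]).
  rewrite -[[:: k; l; i; j]]/([:: k; l] ++ [:: i; j]).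
  by apply: perm_cat; rewrite ?perm_rev // perm_catC.
have -> : (-1) ^+ n.+1 = - (-1) ^+ size (rest [:: i; j; k; l]) :> K.
  by move: (size _) sz => r ->; rewrite !exprS; ring.
by rewrite scalerN scaleNr scalerN opprK scalerA -exprMn mulrNN mulr1 expr1n scale1r.
Qed.

(** Take m, respectively i and j, as the first of the remaining letters, and use
   the Jacobi identity of x_i, x_j, x_m inside the bracket. *)
Lemma dbracket_jacobi i j m k l : uniq [:: i; j; m; k; l] ->
  all (letter n) [:: i; j; m; k; l] ->
  dbracket i j k l + dbracket j m k l + dbracket m i k l = 0.
Proof.
move=> u a; have p := perm_rest u a; set r := rest _ in p.
have pm t : perm_eq t [:: i; j; m; k; l] -> perm_eq (t ++ r) (iota 1 n).
  by move=> pt; apply: perm_trans p; rewrite perm_cat2r.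
have E i' j' m' : perm_eq [:: i'; j'; k; l; m'] [:: i; j; m; k; l] ->
  dbracket i' j' k l = bracket (lnormed x (bracket (bracket (x i') (x j')) (x m')) r)
    (bracket (x k) (x l)).
  by move=> pt; rewrite -(@dbracketE i' j' k l (m' :: r)) //; apply: (pm _ pt).
rewrite (E i j m) ?(E j m i) ?(E m i j); first last.
- by apply/permP => f /=; lia.
- by apply/permP => f /=; lia.
- by apply/permP => f /=; lia.
by rewrite -!bracketDl -!lnormedD jacobi lnormed0 bracket0l.
Qed.

(** The pairs (1, j) label elements that stay independent modulo the second
   derived algebra; the others label double brackets. The label (2, 3) is free, as
   w(12|33) is not multilinear, and serves for the one double bracket that is not
   of the form w(12|3j) or w(1i|2j) with i < j. *)
Definition basis_elt i j :=
  if i == 1%N then lnormed x (bracket (x j) (x 1)) (rest [:: j; 1%N])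
  else if i == 2%N then if j == 3%N then dbracket 1 4 2 3 else dbracket 1 2 3 j
  else dbracket 1 i 2 j.

(** The cases where the label (2, 3) has no basis element: there is no double
   bracket of degree 3, and for n >= 5 odd [Y_43_odd] makes w(14|23) redundant when 2
   is invertible. *)
Definition excluded := (n == 3)%N || (odd n && (2 != 0 :> K)).

Definition basis_index i j := (0 < i < j)%N && (j <= n)%N
  && ~~ (excluded && (i == 2)%N && (j == 3)%N).

Variable U : set L.
Hypothesis sU : submodule U.
Hypothesis basis_in : forall i j, basis_index i j -> U (basis_elt i j).

Lemma dbracket_in i j k l : uniq [:: i; j; k; l] ->
  all (letter n) [:: i; j; k; l] ->
  U (dbracket i j k l).
Proof.
move=> u a.
have n4 : (3 < n)%N.
  by rewrite -(size_iota 1 n) -(perm_size (perm_rest u a)) size_cat /= ; lia.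
apply: (W_in (n := n)) => //.
- exact: dbracket_Cl.
- exact: dbracket_Cr.
- exact: dbracket_swap.
- exact: dbracket_jacobi.
- move=> k' hk; have := (@basis_in 2 k')%N; rewrite /basis_elt /basis_index.
  have -> : (k' == 3)%N = false by lia.
  by rewrite ?andbF; apply; lia.
- move=> i' k' hi hk; have := (@basis_in i' k')%N; rewrite /basis_elt /basis_index.
  have -> : (i' == 1)%N = false by lia. have -> : (i' == 2)%N = false by lia.
  by rewrite ?andbF; apply; lia.
- move=> ex; have := (@basis_in 2 3)%N; rewrite /basis_elt /basis_index /excluded /=.
  have -> : (n == 3)%N = false by lia. rewrite ?(negPf ex). by apply; lia.
Qed.

(** The order of the letters of s matters only at its last two places, where an
   exchange costs a double bracket. So the letter 1, if it is in s, can be moved to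
   the third place, and the Jacobi identity moves it into the first pair. *)
Lemma lnormed_in i j s : perm_eq [:: i, j & s] (iota 1 n) ->
  U (lnormed x (bracket (x i) (x j)) s).
Proof.
pose w i' j' t := lnormed x (bracket (x i') (x j')) t.
have perm_U i' j' s' t' : perm_eq [:: i', j' & s'] (iota 1 n) ->
    perm_eq s' t' -> U (w i' j' t') -> U (w i' j' s').
  move=> p st; suff : perm_eq s' t' /\
      (perm_eq [:: i', j' & s'] (iota 1 n) -> U (w i' j' s' - w i' j' t')).
    by move=> [_ /(_ p)]; apply: submodule_eq.
  move: s' t' st {p}.
  apply: perm_eq_adjacent_ind => [s'|t' s' v' [p1 U1] [p2 U2]|s1 a b s2].
  - by split=> // _; rewrite subrr; case: sU.
  - split=> [|p]; first exact: perm_trans p2.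
    rewrite -(subrKA (w i' j' t')).
    case: (sU) => _ UD _; apply: UD; [exact: U1|apply: U2].
    by apply: perm_trans p; rewrite !perm_cons perm_sym.
  - split=> [|p]; first by rewrite perm_cat2l; apply/permP => f /=; lia.
    rewrite /w lnormed_adjacent.
    rewrite addrAC subrr add0r.
    case: s2 p => [|c s2] p.
      have q : perm_eq ([:: i'; j'; a; b] ++ s1) (iota 1 n).
        apply: perm_trans p; apply/permP => f; rewrite /= !count_cat /=; lia.
      by rewrite dbracketE //; case/perm_restP: q => u l _; apply: dbracket_in.
    rewrite /lnormed /= derived_bracket_central //; last by exists (x a), (x b).
      by rewrite -/(lnormed x 0 s2) lnormed0; case: sU.
    by apply: derived_lnormed; exists (x i'), (x j').
have U1 j' s' : perm_eq [:: j', 1%N & s'] (iota 1 n) ->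
    U (lnormed x (bracket (x j') (x 1)) s').
  move=> p; have /perm_restP[u a ps] : perm_eq ([:: j'; 1%N] ++ s') (iota 1 n) by [].
  apply: perm_U p ps _; have := (@basis_in 1 j')%N; rewrite /basis_elt /basis_index /=; apply.
  by move: u a; rewrite /= !inE /letter; lia.
have U1' j' s' : perm_eq [:: 1%N, j' & s'] (iota 1 n) ->
    U (lnormed x (bracket (x 1) (x j')) s').
  move=> p; rewrite bracketC lnormedN; apply: submoduleN => //; apply: U1.
  by apply: perm_trans p; apply/permP => f /=; lia.
move=> p; have [i1|i1] := eqVneq i 1%N; first by rewrite i1 in p *; apply: U1'.
have [j1|j1] := eqVneq j 1%N; first by rewrite j1 in p *; apply: U1.
have s1 : 1%N \in s.
  have : 1%N \in [:: i, j & s].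
    rewrite (perm_mem p) mem_iota1 /letter.
    by move: (perm_size p); rewrite size_iota /=; lia.
  by rewrite !inE eq_sym (negPf i1) eq_sym (negPf j1).
apply: (perm_U _ _ _ (1%N :: rem 1%N s)) => //; first exact: perm_to_rem.
have {}p : perm_eq [:: i, j, 1%N & rem 1%N s] (iota 1 n).
  by apply: perm_trans p; rewrite !perm_cons perm_sym perm_to_rem.
rewrite /w /lnormed /= bracket_deriv -!/(lnormed x _ _) lnormedD.
rewrite (bracketC (x i) (bracket _ _)) lnormedN.
apply: submoduleB => //.
  apply: (U1 i (j :: rem 1%N s)).
  by apply: perm_trans p; apply/permP => f /=; lia.
apply: (U1 j (i :: rem 1%N s)).
by apply: perm_trans p; apply/permP => f /=; lia.
Qed.

Lemma monomial_in m : (1 < n)%N -> perm_eq (letters m) (iota 1 n) ->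
  U (monomial_eval x m).
Proof.
move=> n1 p; apply: (monomial_left_normed sU) => i s ps.
have {}p := perm_trans ps p; case: s p {ps} => [|j s] p; last exact: lnormed_in.
by move: (perm_size p); rewrite size_iota /=; lia.
Qed.

End CentreByMetabelian.

(** * Lie algebras from a bracket on a subspace *)

Section LieSubspace.
Variables (K : fieldType) (Q : lmodType K) (P : {pred Q}) (br : Q -> Q -> Q).
Hypothesis P_submod : submod_closed P.

(** The argument keeps the closure proof available for instance inference. *)
Definition lie_subspace & submod_closed P : {pred Q} := P.

HB.instance Definition _ := GRing.isSubmodClosed.Build K Q
  (lie_subspace P_submod) P_submod.

Record subspace : Type :=
  Subspace { subspace_val : Q; _ : subspace_val \in lie_subspace P_submod }.

HB.instance Definition _ := [isSub for subspace_val].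
HB.instance Definition _ := [Choice of subspace by <:].
HB.instance Definition _ := [SubChoice_isSubLmodule of subspace by <:].

Hypothesis brPl : forall (b : K) x y z, br (b *: x + y) z = b *: br x z + br y z.
Hypothesis brPr : forall (b : K) x y z, br z (b *: x + y) = b *: br z x + br z y.
Hypothesis br_closed : forall x y, x \in P -> y \in P -> br x y \in P.
Hypothesis brxx : forall x, x \in P -> br x x = 0.
Hypothesis br_jacobi : forall x y z, x \in P -> y \in P -> z \in P ->
  br (br x y) z + br (br y z) x + br (br z x) y = 0.
Hypothesis br_cbm : forall x1 x2 x3 x4 x5,
  br (br (br x1 x2) (br x3 x4)) x5 = 0.

(** The bracket br need be alternating and satisfy the Jacobi identity only on the
   subspace P, which then is an algebra of the variety; its embedding into Q is
   composed with the evaluation map of the relatively free algebra. *)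
Lemma relfree_lie_subspace (v : nat -> Q) : (forall i, v i \in P) ->
  exists f : relfree (centre_by_metabelian K) -> Q,
    [/\ forall (b : K) p q, f (b *: p + q) = b *: f p + f q,
        forall p q, f (bracket p q) = br (f p) (f q)
      & forall i, f (relfree_gen (centre_by_metabelian K) i) = v i].
Proof.
move=> vP.
have brDl x y z : br (x + y) z = br x z + br y z.
  by rewrite -[x in LHS]scale1r brPl scale1r.
have brDr x y z : br z (x + y) = br z x + br z y.
  by rewrite -[x in LHS]scale1r brPr scale1r.
have br0l z : br 0 z = 0 by apply: (addrI (br 0 z)); rewrite -brDl !addr0.
have br0r z : br z 0 = 0 by apply: (addrI (br z 0)); rewrite -brDr !addr0.
pose br' (p q : subspace) : subspace := Subspace (br_closed (valP p) (valP q)).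
have br'Dl p q r : br' (p + q) r = br' p r + br' q r.
  by apply: val_inj; apply: brDl.
have br'Dr p q r : br' p (q + r) = br' p q + br' p r.
  by apply: val_inj; apply: brDr.
have br'Zl (b : K) p q : br' (b *: p) q = b *: br' p q.
  by apply: val_inj; rewrite /= -[_ *: _ in LHS]addr0 brPl br0l addr0.
have br'Zr (b : K) p q : br' p (b *: q) = b *: br' p q.
  by apply: val_inj; rewrite /= -[_ *: _ in LHS]addr0 brPr br0r addr0.
have br'xx p : br' p p = 0 by apply: val_inj; apply: brxx (valP p).
have br'J p q r : br' (br' p q) r + br' (br' q r) p + br' (br' r p) q = 0.
  by apply: val_inj; apply: br_jacobi (valP p) (valP q) (valP r).
pose L : lieAlgType K := HB.pack subspace
  (Lmodule_isLieAlgebra.Build K subspace br'Dl br'Dr br'Zl br'Zr br'xx br'J).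
have LV : in_variety (centre_by_metabelian K) L.
  by move=> _ -> w; apply: val_inj; apply: br_cbm.
have [f [[[fD fZ fB] fx] _]] := relfree_universal (fun i => Subspace (vP i) : L) LV.
exists (subspace_val \o f); split=> [b p q|p q|i] /=.
- by rewrite fD fZ.
- by rewrite fB.
- by rewrite fx.
Qed.

End LieSubspace.

(** * Heisenberg algebras extended by derivations *)

Section Heisenberg.
Variables (K : fieldType) (A M : lmodType K).
Variables (act : A -> M -> M) (form : M -> M -> K).
Implicit Types (a b : A) (u v w : M) (x : K).

Local Notation triples := (A * M * K^o)%type.

(** On A + M + K the abelian algebra A acts on the Heisenberg algebra M + K by
   derivations that vanish on K. *)
Definition heisenberg_bracket (e e' : triples) : triples :=
  (0, act e'.1.1 e.1.2 - act e.1.1 e'.1.2, form e.1.2 e'.1.2).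

Variable P : {pred triples}.
Hypothesis P_submod : submod_closed P.
Hypothesis P_closed : forall e e', e \in P -> e' \in P ->
  heisenberg_bracket e e' \in P.

Hypothesis actPl : forall x a b u, act (x *: a + b) u = x *: act a u + act b u.
Hypothesis actPr : forall x a u v, act a (x *: u + v) = x *: act a u + act a v.
Hypothesis formPl : forall x u v w,
  form (x *: u + v) w = x * form u w + form v w.
Hypothesis formPr : forall x u v w,
  form w (x *: u + v) = x * form w u + form w v.
Hypothesis actC : forall a b u, act a (act b u) = act b (act a u).
Hypothesis form_act : forall a u v, form (act a u) v = - form u (act a v).
Hypothesis form_alt : forall e, e \in P -> form e.1.2 e.1.2 = 0.
Hypothesis form_act_skew : forall a e e', e \in P -> e' \in P ->
  form (act a e.1.2) e'.1.2 = - form e'.1.2 (act a e.1.2).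

Lemma heisenberg_Pl x e e' e2 : heisenberg_bracket (x *: e + e') e2 =
  x *: heisenberg_bracket e e2 + heisenberg_bracket e' e2.
Proof.
case: e e' e2 => [[a u] z] [[a' u'] z'] [[a2 u2] z2].
rewrite /heisenberg_bracket /= actPl actPr formPl opprD addrACA -scalerBr.
by apply: injective_projections; first apply: injective_projections;
  rewrite //= scaler0 addr0.
Qed.

Lemma heisenberg_Pr x e e' e2 : heisenberg_bracket e2 (x *: e + e') =
  x *: heisenberg_bracket e2 e + heisenberg_bracket e2 e'.
Proof.
case: e e' e2 => [[a u] z] [[a' u'] z'] [[a2 u2] z2].
rewrite /heisenberg_bracket /= actPl actPr formPr opprD addrACA -scalerBr.
by apply: injective_projections; first apply: injective_projections;
  rewrite //= scaler0 addr0.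
Qed.

Let act0l u : act 0 u = 0.
Proof.
have /eqP := actPl 1 0 0 u; rewrite !scale1r addr0 -subr_eq0 opprD addNKr.
by rewrite oppr_eq0 => /eqP.
Qed.

Let actB a u v : act a (u - v) = act a u - act a v.
Proof. by rewrite addrC -scaleN1r actPr scaleN1r addrC. Qed.

Let formB u v w : form (u - v) w = form u w - form v w.
Proof. by rewrite addrC -scaleN1r formPl mulN1r addrC. Qed.

(** The component in M cancels since A acts by commuting operators; in the central
   component, [form_act] and the skew-symmetry of the form cancel the six terms in
   pairs. *)
Lemma heisenberg_jacobi e1 e2 e3 : e1 \in P -> e2 \in P -> e3 \in P ->
  heisenberg_bracket (heisenberg_bracket e1 e2) e3
    + heisenberg_bracket (heisenberg_bracket e2 e3) e1
    + heisenberg_bracket (heisenberg_bracket e3 e1) e2 = 0.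
Proof.
case: e1 e2 e3 => [[a1 u1] z1] [[a2 u2] z2] [[a3 u3] z3] P1 P2 P3.
rewrite /heisenberg_bracket /= !act0l !subr0 !actB !formB.
have skew12 := form_act_skew a3 P1 P2; have skew23 := form_act_skew a1 P2 P3.
have skew31 := form_act_skew a2 P3 P1.
apply: injective_projections; first apply: injective_projections; rewrite /=.
- by rewrite !addr0.
- by rewrite (actC a3 a2) (actC a3 a1) (actC a2 a1) subrKA addrC subrKA subrr.
- move: skew12 skew23 skew31; rewrite /= (form_act a2 u1) (form_act a3 u2).
  rewrite (form_act a1 u3) => -> -> ->.
  by ring.
Qed.

(** A commutator has no component in A, so the commutator of two commutators is in
   K, on which everything acts by 0. *)
Lemma heisenberg_cbm e1 e2 e3 e4 e5 :
  heisenberg_bracket (heisenberg_bracket (heisenberg_bracket e1 e2)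
    (heisenberg_bracket e3 e4)) e5 = 0.
Proof.
rewrite /heisenberg_bracket /= !act0l subrr subr0.
have act0 a : act a 0 = 0 by rewrite -[0 in LHS](subrr 0) actB subrr.
have form0 w : form 0 w = 0 by rewrite -[X in form X](subrr 0) formB subrr.
by rewrite act0 form0.
Qed.

Lemma relfree_heisenberg (v : nat -> triples) : (forall i, v i \in P) ->
  exists f : relfree (centre_by_metabelian K) -> triples,
    [/\ forall (b : K) p q, f (b *: p + q) = b *: f p + f q,
        forall p q, f (bracket p q) = heisenberg_bracket (f p) (f q)
      & forall i, f (relfree_gen (centre_by_metabelian K) i) = v i].
Proof.
apply: (relfree_lie_subspace P_submod heisenberg_Pl heisenberg_Pr P_closed).
- move=> e Pe; rewrite /heisenberg_bracket subrr form_alt //.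
- exact: heisenberg_jacobi.
- exact: heisenberg_cbm.
Qed.

End Heisenberg.

(** * Models of the variety *)

Section Model.
Variables (K : fieldType) (I : finType) (G : I -> I -> K) (lam : K).

Local Notation scalars := {ffun I -> K^o}.
Local Notation tensors := {ffun {set I} * I -> K^o}.

Implicit Types (a b : scalars) (u v w : tensors) (A B : {set I}) (c d i k : I).

(** Vectors of the module are families u (A, i), thought of as the coefficients of
   m_i t^S, where S is A without i: A collects all letters used, and only the
   coordinates with i in A are meaningful. The operator [act1 c] is multiplication by
   the variable t_c, with t_c^2 = 0 and m_c t_c = 0. *)
Definition act1 c u : tensors :=
  [ffun p : {set I} * I => if (c \in p.1) && (c != p.2) then u (p.1 :\ c, p.2) else 0].

Definition act a u : tensors := \sum_c a c *: act1 c u.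

(** The pairing of the component A with the complementary component. The sign makes
   the operators [act1 c] skew-adjoint, since moving c between the two components
   changes the size of the complement by one. *)
Definition form_at u v A : K :=
  (-1) ^+ #|~: A| * \sum_(i in A) \sum_(k in ~: A) G i k * u (A, i) * v (~: A, k).

Definition form u v : K := \sum_A form_at u v A.

(** The sum of the coordinates over the letters used; it vanishes on multiples of
   m_i t_j - m_j t_i. *)
Definition total A u : K := \sum_(i in A) u (A, i).

Lemma act1_is_linear c : linear (act1 c).
Proof.
move=> x u v; apply/ffunP => p; rewrite !ffunE.
by case: ifP; rewrite // scaler0 addr0.
Qed.

HB.instance Definition _ c := GRing.isLinear.Build K tensors tensors _
  (act1 c) (act1_is_linear c).

Lemma act_is_linear a : linear (act a).
Proof.
move=> x u v; rewrite /act scaler_sumr -big_split; apply: eq_bigr => c _ /=.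
by rewrite linearP scalerDr !scalerA mulrC.
Qed.

HB.instance Definition _ a := GRing.isLinear.Build K tensors tensors _
  (act a) (act_is_linear a).

Lemma actPl x a b u : act (x *: a + b) u = x *: act a u + act b u.
Proof.
rewrite /act scaler_sumr -big_split; apply: eq_bigr => c _ /=.
by rewrite !ffunE scalerDl scalerA.
Qed.

Lemma act0l u : act 0 u = 0.
Proof. by rewrite /act big1 // => c _; rewrite ffunE scale0r. Qed.

Lemma formPl x u w v : form (x *: u + w) v = x * form u v + form w v.
Proof.
rewrite /form mulr_sumr -big_split; apply: eq_bigr => A _ /=.
rewrite /form_at mulrCA -mulrDr; congr (_ * _).
rewrite mulr_sumr -big_split; apply: eq_bigr => i _ /=.
rewrite mulr_sumr -big_split; apply: eq_bigr => k _ /=.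
by rewrite !ffunE /GRing.scale /=; ring.
Qed.

Lemma formDl u w v : form (u + w) v = form u v + form w v.
Proof. by rewrite -[u in LHS]scale1r formPl mul1r. Qed.

Lemma form0l v : form 0 v = 0.
Proof. by apply: (addrI (form 0 v)); rewrite -formDl !addr0. Qed.

Lemma formZl x u v : form (x *: u) v = x * form u v.
Proof. by rewrite -[x *: u]addr0 formPl form0l addr0. Qed.

Lemma formBl u w v : form (u - w) v = form u v - form w v.
Proof. by rewrite formDl -scaleN1r formZl mulN1r. Qed.

Lemma form_is_linear u : linear_for *%R (form u).
Proof.
move=> x v w; rewrite /form mulr_sumr -big_split; apply: eq_bigr => A _ /=.
rewrite /form_at mulrCA -mulrDr; congr (_ * _).
rewrite mulr_sumr -big_split; apply: eq_bigr => i _ /=.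
rewrite mulr_sumr -big_split; apply: eq_bigr => k _ /=.
by rewrite !ffunE /GRing.scale /=; ring.
Qed.

HB.instance Definition _ u := GRing.isLinear.Build K tensors K _
  (form u) (form_is_linear u).

Lemma total_is_linear A : linear_for *%R (total A).
Proof.
move=> x u v; rewrite /total mulr_sumr -big_split; apply: eq_bigr => i _ /=.
by rewrite !ffunE.
Qed.

HB.instance Definition _ A := GRing.isLinear.Build K tensors K _
  (total A) (total_is_linear A).

Lemma act1C c d u : act1 c (act1 d u) = act1 d (act1 c u).
Proof.
apply/ffunP => -[A i]; rewrite !ffunE /= !inE.
have -> : A :\ c :\ d = A :\ d :\ c by rewrite !finset.setDDl finset.setUC.
rewrite (eq_sym d c).
by case: (c \in A); case: (d \in A); case: (c == i); case: (d == i);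
  case: (c == d); rewrite //= ?andbF ?andbT.
Qed.

Lemma actC u a b : act a (act b u) = act b (act a u).
Proof.
rewrite /act; under eq_bigr => c _ do rewrite linear_sum scaler_sumr.
under [RHS]eq_bigr => c _ do rewrite linear_sum scaler_sumr.
rewrite exchange_big; apply: eq_bigr => d _; apply: eq_bigr => c _ /=.
by rewrite !linearZ /= act1C !scalerA mulrC.
Qed.

(** Both sides are sums over the ways of writing I as a disjoint union of {c} and
   two sets; reindex by adjoining c to the first or to the second set. *)
Lemma form_act1 c u v : form (act1 c u) v = - form u (act1 c v).
Proof.
rewrite /form (bigID (fun A => c \in A)) /= [X in _ + X]big1 ?addr0; last first.
  move=> A /negPf cA; rewrite /form_at big1 ?mulr0 // => i _.
  by rewrite big1 // => k _; rewrite ffunE /= cA mulr0 mul0r.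
rewrite [X in _ = - X](bigID (fun A => c \in A)) /= [X in - (X + _)]big1 ?add0r; last first.
  move=> A cA; rewrite /form_at big1 ?mulr0 // => i _.
  by rewrite big1 // => k _; rewrite ffunE /= inE cA mulr0.
rewrite (reindex_onto (fun A => c |: A) (fun A => A :\ c)) /=; last first.
  by move=> A cA; rewrite finset.setD1K.
rewrite -sumrN; apply: eq_big => A.
  rewrite finset.setU11 /=; apply/eqP/idP => [<-|cA]; first by rewrite !inE eqxx.
  by rewrite finset.setU1K.
move=> /andP[_ /eqP cA]; have {}cA : c \notin A by rewrite -cA !inE eqxx.
have cE : ~: (c |: A) = ~: A :\ c by rewrite finset.setCU finset.setIC -finset.setDE.
rewrite /form_at -mulNr; congr (_ * _).
  by rewrite (cardsD1 c (~: A)) inE cA exprS mulN1r opprK cE.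
rewrite big_setU1 //= [X in X + _]big1 ?add0r; last first.
  by move=> k _; rewrite ffunE /= eqxx andbF mulr0 mul0r.
apply: eq_bigr => i iA; rewrite [RHS](big_setD1 c) ?inE //=.
rewrite [act1 c v _]ffunE /= eqxx andbF mulr0 add0r cE.
apply: eq_bigr => k; rewrite !inE => /andP[kc kA].
rewrite !ffunE /= !inE eqxx (eq_sym c k) kc cA /= finset.setU1K //.
by have -> : c != i by apply: contraNneq cA => ->.
Qed.

Lemma form_act u v a : form (act a u) v = - form u (act a v).
Proof.
rewrite /act linear_sum (big_morph (form^~ v) (fun u w => formDl u w v) (form0l v)) -sumrN.
apply: eq_bigr => c _ /=; by rewrite formZl linearZ /= form_act1 mulrN.
Qed.

Lemma total_act1 c u A :
  total A (act1 c u) = if c \in A then total (A :\ c) u else 0.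
Proof.
rewrite /total; case: ifP => cA; last first.
  by rewrite big1 // => i _; rewrite ffunE /= cA.
rewrite (big_setD1 c) //= ffunE /= eqxx andbF add0r; apply: eq_bigr => i.
by rewrite !inE => /andP[ic _]; rewrite ffunE /= cA eq_sym ic.
Qed.

Hypothesis G_sym : forall i k, i != k -> G i k + (-1) ^+ #|I| * G k i = lam.

(** The matrix G is skew up to sign and up to the constant lam, and the constant
   contributes a product of totals. *)
Lemma form_at_sym u v A : form_at u v A + form_at v u (~: A) =
  lam * ((-1) ^+ #|~: A| * (total A u * total (~: A) v)).
Proof.
rewrite /form_at finset.setCK [X in _ + _ * X]exchange_big /=.
have -> : (-1) ^+ #|A| = (-1) ^+ #|~: A| * (-1) ^+ #|I| :> K.
  rewrite -exprD -(cardsC A) addnCA exprD addnn -mul2n exprM sqrrN expr1n.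
  by rewrite expr1n mulr1.
rewrite -mulrA -mulrDr mulrCA; congr (_ * _).
rewrite mulr_sumr -big_split mulr_suml mulr_sumr; apply: eq_bigr => i iA /=.
rewrite mulr_sumr -big_split mulr_sumr mulr_sumr; apply: eq_bigr => k kA /=.
rewrite -(G_sym (i := i) (k := k)); first by ring.
by apply: contraTneq iA => ->; move: kA; rewrite inE.
Qed.

Lemma form_sym u v :
  (forall A, lam * (total A u * total (~: A) v) = 0) -> form u v = - form v u.
Proof.
move=> uv; apply/eqP; rewrite -addr_eq0 [X in _ + X](reindex_inj (@finset.setC_inj I)) /=.
rewrite -big_split big1 //= => A _; rewrite form_at_sym mulrCA uv mulr0 //.
Qed.

(** The components of A and of its complement cancel. To pair them off also in
   characteristic 2, fix a point o of I and let A be the one that contains o. *)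
Lemma form_alt u :
  (forall A, lam * (total A u * total (~: A) u) = 0) -> form u u = 0.
Proof.
move=> uu; have [o _|I0] := pickP I; last first.
  rewrite /form big1 // => A _; rewrite /form_at big1 ?mulr0 // => i.
  by have := I0 i.
rewrite /form (bigID (fun A => o \in A)) /=.
rewrite [X in _ + X](reindex_inj (@finset.setC_inj I)) /=.
rewrite [X in _ + X](eq_bigl (fun A => o \in A)); last first.
  by move=> A; rewrite inE negbK.
by rewrite -big_split big1 //= => A _; rewrite form_at_sym mulrCA uu mulr0.
Qed.

Local Notation triples := (scalars * tensors * K^o)%type.
Implicit Types e : triples.

Local Notation mbracket := (heisenberg_bracket act form).

(** The subalgebra generated by the elements [generator c] lies in here: the
   totals are those of sum_c a_c m_c in degree one and vanish in higher degrees, so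
   that the form becomes skew on it even when lam is not 0. *)
Definition balanced : {pred triples} :=
  fun e => [forall A, total A e.1.2 == \sum_(c | A == [set c]) e.1.1 c].

Lemma balancedP e : reflect
  (forall A, total A e.1.2 = \sum_(c | A == [set c]) e.1.1 c) (e \in balanced).
Proof. exact: 'forall_eqP. Qed.

Lemma balanced_submod : submod_closed balanced.
Proof.
split=> [|x e e' /balancedP be /balancedP be']; apply/balancedP => A /=.
  by rewrite linear0 big1 // => c _; rewrite ffunE.
rewrite linearP /= be be' mulr_sumr -big_split /=; apply: eq_bigr => c _.
by rewrite !ffunE.
Qed.

Lemma pair_setE c d A :
  (c \in A) && (A :\ c == [set d]) = (c != d) && (A == [set c; d]).
Proof.
apply/andP/andP => [[cA /eqP Ad]|[cd /eqP ->]]; split=> //.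
- by have : d \in A :\ c by [rewrite Ad inE]; rewrite !inE eq_sym; case/andP.
- by rewrite -(finset.setD1K cA) Ad.
- by rewrite !inE eqxx.
- by rewrite finset.setU1K // inE.
Qed.

Lemma total_act e a A : e \in balanced -> total A (act a e.1.2) =
  \sum_c \sum_(d | (c != d) && (A == [set c; d])) a c * e.1.1 d.
Proof.
move=> /balancedP be; rewrite /act linear_sum; apply: eq_bigr => c _ /=.
rewrite linearZ /= total_act1 be.
rewrite [RHS](eq_bigl (fun d => (c \in A) && (A :\ c == [set d]))).
  by case: (c \in A); rewrite /= ?mulr_sumr ?mulr0 ?big_pred0_eq.
by move=> d; rewrite pair_setE.
Qed.

(** In degree 2 the totals of m_c t_d and m_d t_c agree. *)
Lemma balanced_bracket e e' :
  e \in balanced -> e' \in balanced -> mbracket e e' \in balanced.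
Proof.
move=> be be'; rewrite /heisenberg_bracket; apply/balancedP => A /=.
rewrite big1 => [|c _]; last first.
  by rewrite ffunE.
rewrite linearB /= !total_act // [X in _ - X](exchange_big_dep xpredT) //=.
apply/eqP; rewrite subr_eq0; apply/eqP; apply: eq_bigr => c _.
by apply: eq_big => [d|d _]; rewrite 1?mulrC // eq_sym finset.setUC.
Qed.

Hypothesis lam_card : lam = 0 \/ (3 < #|I|)%N.

Lemma total_balanced0 e A : e \in balanced -> #|A| != 1 -> total A e.1.2 = 0.
Proof.
move=> /balancedP -> A1; rewrite big_pred0 // => c.
by apply: contraNF A1 => /eqP ->; rewrite cards1.
Qed.

Lemma total_act0 e a A : e \in balanced -> #|A| != 2 -> total A (act a e.1.2) = 0.
Proof.
move=> be A2; rewrite total_act // big1 // => c _; rewrite big_pred0 // => d.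
by apply: contraNF A2 => /andP[cd /eqP ->]; rewrite cards2 cd.
Qed.

Lemma form_balanced_alt e : e \in balanced -> form e.1.2 e.1.2 = 0.
Proof.
move=> be; apply: form_alt => A.
case: lam_card => [->|I4]; first by rewrite mul0r.
have [A1|A1] := eqVneq #|A| 1; last by rewrite total_balanced0 // mul0r mulr0.
rewrite (total_balanced0 be (A := ~: A)) ?mulr0 //.
by apply: contraTneq I4 => A1'; rewrite -(cardsC A) A1 A1'.
Qed.

(** By [form_sym], the defect is lam times products of totals over complementary
   sets of 2 and 1 letters, and there are at least 4 letters unless lam = 0. *)
Lemma form_act_sym e e' a : e \in balanced -> e' \in balanced ->
  form (act a e.1.2) e'.1.2 = - form e'.1.2 (act a e.1.2).
Proof.
move=> be be'; apply: form_sym => A.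
case: lam_card => [->|I4]; first by rewrite mul0r.
have [A2|A2] := eqVneq #|A| 2; last by rewrite total_act0 // mul0r mulr0.
rewrite (total_balanced0 be' (A := ~: A)) ?mulr0 //.
by apply: contraTneq I4 => A1'; rewrite -(cardsC A) A2 A1'.
Qed.

(** The balanced triples form an algebra of the variety for every admissible G, so
   elements of it can be prescribed as the images of the generators. *)
Lemma relfree_model (x : nat -> triples) : (forall j, x j \in balanced) ->
  exists f : relfree (centre_by_metabelian K) -> triples,
    [/\ forall (b : K) p q, f (b *: p + q) = b *: f p + f q,
        forall p q, f (bracket p q) = mbracket (f p) (f q)
      & forall j, f (relfree_gen (centre_by_metabelian K) j) = x j].
Proof.
apply: relfree_heisenberg.
- exact: balanced_submod.
- exact: balanced_bracket.
- exact: actPl.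
- by move=> y a u v; rewrite linearP.
- exact: formPl.
- by move=> y u v w; rewrite linearP.
- by move=> a b u; apply: actC.
- by move=> a u v; apply: form_act.
- exact: form_balanced_alt.
- by move=> a e e'; apply: form_act_sym.
Qed.

(** The vector m_i t^S, where S is A without i. *)
Definition pure A i : tensors := [ffun p => (p == (A, i))%:R].

Lemma act1_pure c A i : c \notin A -> i \in A ->
  act1 c (pure A i) = pure (c |: A) i.
Proof.
move=> cA iA; apply/ffunP => -[B k]; rewrite !ffunE /= !xpair_eqE.
case: (eqVneq k i) => [->|]; rewrite ?andbF ?if_same //= !andbT.
have -> : c != i by apply: contraNneq cA => ->.
rewrite andbT; case: ifP => cB.
  congr ((_ : bool) : nat)%:R.
  by apply/eqP/eqP => [<-|->]; rewrite ?finset.setD1K ?finset.setU1K.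
by rewrite (_ : _ == _ = false) //; apply: contraFF cB => /eqP ->; rewrite finset.setU11.
Qed.

Lemma form_pure A i B k : i \in A -> k \in B ->
  form (pure A i) (pure B k) =
  if B == ~: A then (-1) ^+ #|B| * G i k else 0.
Proof.
move=> iA kB; rewrite /form (bigD1 A) //= [X in _ + X]big1 ?addr0; last first.
  move=> C /negPf CA; rewrite /form_at big1 ?mulr0 // => j _.
  by rewrite big1 // => l _; rewrite !ffunE !xpair_eqE CA /= mulr0 mul0r.
rewrite /form_at (bigD1 i) //= [X in _ * (_ + X)]big1 ?addr0; last first.
  move=> j /andP[_ /negPf ji].
  by rewrite big1 // => l _; rewrite !ffunE !xpair_eqE ji /= andbF mulr0 mul0r.
case: eqP => [BA|/eqP BA]; last first.
  rewrite big1 ?mulr0 // => l _; rewrite !ffunE !xpair_eqE (eq_sym _ B).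
  by rewrite (negPf BA) mulr0.
rewrite -BA (bigD1 k) //= big1 ?addr0; last first.
  by move=> l /andP[_ /negPf lk]; rewrite !ffunE !xpair_eqE lk andbF mulr0.
by rewrite !ffunE !eqxx !mulr1.
Qed.

(** The Magnus-type element D_c + m_c, with D_c acting as multiplication by t_c. *)
Definition generator c : triples :=
  ([ffun d => (d == c)%:R], pure [set c] c, 0).

Lemma generator_balanced c : generator c \in balanced.
Proof.
apply/balancedP => A /=; rewrite /total.
have [->|Ac] := eqVneq A [set c].
  rewrite big_set1 ffunE eqxx (bigD1 c) //= ffunE eqxx big1 ?addr0 // => d.
  by move=> /andP[/eqP /set1_inj -> ]; rewrite eqxx.
rewrite !big1 // => [d /eqP Ad|d _]; rewrite ffunE ?xpair_eqE ?(negPf Ac) //.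
by case: eqP => // dc; rewrite Ad dc eqxx in Ac.
Qed.

Lemma act_generator c u : act (generator c).1.1 u = act1 c u.
Proof.
rewrite /act (bigD1 c) //= ffunE eqxx scale1r big1 ?addr0 // => d /negPf dc.
by rewrite ffunE dc scale0r.
Qed.

Lemma mbracket_generator e c : (mbracket e (generator c)).1 =
  (0, act1 c e.1.2 - act e.1.1 (pure [set c] c)).
Proof. by rewrite /heisenberg_bracket act_generator. Qed.

End Model.

(** * Values of the spanning elements in the models *)

Section Evaluation.
Variables (K : fieldType) (I : finType) (G : I -> I -> K) (n : nat).
Variable v : nat -> I.
Hypothesis v_perm : perm_eq (map v (iota 1 n)) (enum I).

Local Notation CBM := (centre_by_metabelian K).
Local Notation x := (@relfree_gen K CBM).
Local Notation triples :=
  ({ffun I -> K^o} * {ffun {set I} * I -> K^o} * K^o)%type.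

Variable f : relfree CBM -> triples.
Hypothesis f_bracket : forall p q,
  f (bracket p q) = heisenberg_bracket (@act K I) (form G) (f p) (f q).
Hypothesis f_gen : forall j, f (x j) = generator K (v j).

Lemma v_uniq s : perm_eq s (iota 1 n) -> uniq (map v s).
Proof.
by move=> p; rewrite (perm_uniq (perm_trans (perm_map v p) v_perm)) enum_uniq.
Qed.

Lemma v_mem s c : perm_eq s (iota 1 n) -> c \in map v s.
Proof.
by move=> p; rewrite (perm_mem (perm_trans (perm_map v p) v_perm)) mem_enum.
Qed.

Lemma eval_bracket_gen i j : v i != v j ->
  (f (bracket (x i) (x j))).1 =
  (0, pure K [set v i; v j] (v i) - pure K [set v i; v j] (v j)).
Proof.
move=> ij; rewrite f_bracket !f_gen mbracket_generator act_generator [(generator _ _).1.2]/=.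
have gen_act (c d : I) : c != d -> act1 c (generator K d).1.2 = pure K [set c; d] d.
  by move=> cd; apply: act1_pure; rewrite inE.
rewrite (gen_act _ _ ij) gen_act; last by rewrite eq_sym.
by rewrite (finset.setUC [set v j]).
Qed.

(** By induction from [x_i, x_j], which is m_i t_j - m_j t_i up to a central term. *)
Lemma eval_lnormed i j s : uniq (map v [:: i, j & s]) ->
  let A := [set c in map v [:: i, j & s]] in
  (f (lnormed x (bracket (x i) (x j)) s)).1 =
  (0, pure K A (v i) - pure K A (v j)).
Proof.
elim/last_ind: s => [|s c IHs].
  rewrite /= inE andbT => ij; rewrite (eval_bracket_gen ij).
  have <- : [set c in [:: v i; v j]] = [set v i; v j].
    by apply/setP => c; rewrite !inE.
  by [].
rewrite -!rcons_cons map_rcons rcons_uniq => /andP[cs us]; cbv zeta.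
have := IHs us; cbv zeta; set A := [set z in map v [:: i, j & s]] => fA.
set A' := [set z in rcons _ _].
have AE : v c |: A = A'.
  by apply/setP => d; rewrite finset.in_setU1 !finset.in_set mem_rcons in_cons.
have act_c k : k \in [:: i; j] ->
    act1 (v c) (pure K A (v k)) = pure K A' (v k).
  move=> kij; rewrite -AE; apply: act1_pure; first by rewrite inE.
  by rewrite inE map_f // -[[:: i, j & s]]/([:: i; j] ++ s) mem_cat kij.
rewrite lnormed_rcons f_bracket f_gen mbracket_generator fA [_.1]/= [_.2]/=.
by rewrite act0l subr0 linearB /= (act_c i (mem_head _ _)) (act_c j (mem_last i [:: j])).
Qed.

(** The element of L' attached to i, j and all letters but k, l is paired with
   m_k t_l - m_l t_k; the sign of the form is (-1)^2. *)
Lemma eval_dbracket i j k l : uniq [:: i; j; k; l] ->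
  all (letter n) [:: i; j; k; l] ->
  f (dbracket x n i j k l) =
  (0, 0, G (v i) (v k) - G (v i) (v l) - G (v j) (v k) + G (v j) (v l)).
Proof.
move=> u a; set r := rest n [:: i; j; k; l].
have p : perm_eq ([:: k; l] ++ [:: i, j & r]) (iota 1 n).
  apply: perm_trans (perm_rest u a).
  by rewrite (perm_catCA [:: k; l] [:: i; j] r).
have := v_uniq p; rewrite map_cat cat_uniq => /and3P[ukl /hasPn disj uA].
have kl : v k != v l by move: ukl; rewrite /= inE andbT.
have := eval_lnormed uA; cbv zeta.
set A := [set c in _] => fA.
have AE : [set v k; v l] = ~: A.
  apply/setP => c; have := v_mem c p; rewrite map_cat mem_cat.
  rewrite [RHS]finset.in_setC [in RHS]finset.in_set; case: (boolP (c \in map v [:: i, j & r])) => [/disj|_].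
    by rewrite /= !inE => /negPf ->.
  by rewrite /= !inE orbF.
rewrite /dbracket -/r f_bracket /heisenberg_bracket fA (eval_bracket_gen kl).
rewrite ![_.1]/= ![_.2]/= !act0l subrr formBl !linearB /=.
have ki : v i \in A by rewrite inE /= inE eqxx.
have kj : v j \in A by rewrite inE /= !inE eqxx orbT.
rewrite !form_pure ?inE ?eqxx ?orbT // AE eqxx -AE cards2 kl sqrrN expr1n !mul1r.
by congr (_, _, _); rewrite opprB addrA addrAC.
Qed.

Lemma eval_basis_elt1 j : (1 < j <= n)%N ->
  (f (basis_elt x n 1 j)).1.2 = pure K finset.setT (v j) - pure K finset.setT (v 1%N).
Proof.
move=> jn; have p : perm_eq ([:: j; 1%N] ++ rest n [:: j; 1%N]) (iota 1 n).
  by apply: perm_rest; rewrite /= ?inE /letter; lia.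
have := eval_lnormed (v_uniq p); cbv zeta; set A := [set c in _] => fA.
have AE : A = finset.setT.
  by apply/setP => c; rewrite finset.in_set finset.in_setT; apply: v_mem p.
by rewrite /basis_elt eqxx fA AE.
Qed.

End Evaluation.

Section MonomialOf.
Variables (K : fieldType) (L : lieAlgType K) (x : nat -> L).

Lemma monomial_lnormed m s : exists m',
  monomial_eval x m' = lnormed x (monomial_eval x m) s /\ letters m' = letters m ++ s.
Proof.
elim: s m => [|c s IHs] m; first by exists m; rewrite cats0.
by have [m' [E El]] := IHs (MBracket m (MVar c)); exists m'; rewrite E El -catA.
Qed.

Lemma dbracket_monomial n i j k l : uniq [:: i; j; k; l] ->
  all (letter n) [:: i; j; k; l] ->
  exists2 m, multilinear_monomial n m & monomial_eval x m = dbracket x n i j k l.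
Proof.
move=> u a; have [m [mE ml]] :=
  monomial_lnormed (MBracket (MVar i) (MVar j)) (rest n [:: i; j; k; l]).
exists (MBracket m (MBracket (MVar k) (MVar l))); last by rewrite /= mE.
rewrite /multilinear_monomial /= ml; apply: perm_trans (perm_rest u a).
by apply/permP => f; rewrite /= !count_cat /=; lia.
Qed.

Lemma basis_elt_monomial n i j : (1 < n)%N -> basis_index K n i j ->
  exists2 m, multilinear_monomial n m & monomial_eval x m = basis_elt x n i j.
Proof.
move=> n1; rewrite /basis_index /basis_elt => ij; case: eqP => [i1|/eqP i1].
  have [m [mE ml]] :=
    monomial_lnormed (MBracket (MVar j) (MVar 1)) (rest n [:: j; 1%N]).
  exists m => //; rewrite /multilinear_monomial /= ml; apply: perm_rest.
    by rewrite /= !inE; lia.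
  by rewrite /= /letter; lia.
case: eqP => [i2|/eqP i2].
  have [j3|j3] := eqVneq j 3%N; apply: dbracket_monomial;
    rewrite /= ?inE /letter; move: ij; rewrite /excluded i2 ?j3; lia.
by apply: dbracket_monomial; rewrite /= ?inE /letter; lia.
Qed.

End MonomialOf.

(** * Linear independence *)

Section Independence.
Variables (K : fieldType) (m : nat).
Let n := m.+2.
Local Notation CBM := (centre_by_metabelian K).
Local Notation x := (@relfree_gen K CBM).

Let v (i : nat) : 'I_n := inord i.-1.

Lemma v_val i : letter n i -> (v i : nat).+1 = i.
Proof. by rewrite /letter /v => il; rewrite inordK; lia. Qed.

Lemma v_eq i j : letter n i -> letter n j -> (v i == v j) = (i == j).
Proof. by move=> il jl; rewrite -val_eqE /= -eqSS !v_val. Qed.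

Lemma v_perm_enum : perm_eq (map v (iota 1 n)) (enum 'I_n).
Proof.
suff -> : map v (iota 1 n) = enum 'I_n by [].
apply: (inj_map val_inj); rewrite val_enum_ord -map_comp (iotaDl 1 0) -map_comp.
rewrite -[RHS]map_id; apply/eq_in_map => i; rewrite mem_iota /= => il.
by rewrite /v inordK; lia.
Qed.

Variable a : nat -> nat -> K.
Hypothesis a_supp : forall i j, ~~ basis_index K n i j -> a i j = 0.
Hypothesis a_dep :
  \sum_(p : 'I_n.+1 * 'I_n.+1) a p.1 p.2 *: basis_elt x n p.1 p.2 = 0.

Lemma dependence_functional (h : relfree CBM -> K) :
  (forall (b : K) p q, h (b *: p + q) = b * h p + h q) ->
  \sum_(p : 'I_n.+1 * 'I_n.+1) a p.1 p.2 * h (basis_elt x n p.1 p.2) = 0.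
Proof.
move=> hP.
have hD p q : h (p + q) = h p + h q by rewrite -[p in LHS]scale1r hP mul1r.
have h0 : h 0 = 0 by apply: (addrI (h 0)); rewrite -hD !addr0.
have hZ b p : h (b *: p) = b * h p by rewrite -[b *: p]addr0 hP h0 addr0.
have := congr1 h a_dep; rewrite h0 (big_morph h hD h0) => E; rewrite -[RHS]E.
by apply: eq_bigr => p _; rewrite hZ.
Qed.

Lemma sum_pick (F : nat -> nat -> K) i0 j0 : (i0 <= n)%N -> (j0 <= n)%N ->
  (forall i j, basis_index K n i j -> (i, j) != (i0, j0) -> a i j * F i j = 0) ->
  \sum_(p : 'I_n.+1 * 'I_n.+1) a p.1 p.2 * F p.1 p.2 = a i0 j0 * F i0 j0.
Proof.
move=> i0n j0n F0; rewrite (bigD1 (inord i0, inord j0)) //= !inordK //.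
rewrite big1 ?addr0 // => -[i j] /= ij.
have [b|b] := boolP (basis_index K n i j); last by rewrite a_supp // mul0r.
apply: F0 => //; apply: contraNneq ij => -[<- <-].
by rewrite !inord_val.
Qed.

Definition quad (g : nat -> nat -> K) i j k l := g i k - g i l - g j k + g j l.

(** By [eval_dbracket]; the value 0 for i = 1 is a filler, used once the corresponding
   coefficients are known to vanish. *)
Definition basis_value g (i j : nat) : K :=
  if i == 1%N then 0
  else if i == 2%N then if j == 3%N then quad g 1 4 2 3 else quad g 1 2 3 j
  else quad g 1 i 2 j.

(** The component in M of the model singles out the coefficients a 1 j; once these
   are 0, the central component gives a relation for each admissible matrix g. *)
Lemma dependence_values g lam :
  (forall i k, i != k -> g i k + (-1) ^+ n * g k i = lam) ->
  lam = 0 \/ (3 < n)%N ->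
  (forall j, (1 < j <= n)%N -> a 1%N j = 0) /\
  \sum_(p : 'I_n.+1 * 'I_n.+1) a p.1 p.2 * basis_value g p.1 p.2 = 0.
Proof.
move=> g_sym lam_n.
pose G (i k : 'I_n) := g i.+1 k.+1.
have GE i k : letter n i -> letter n k -> G (v i) (v k) = g i k.
  by move=> il kl; rewrite /G !v_val.
have G_sym (i k : 'I_n) : i != k -> G i k + (-1) ^+ #|'I_n| * G k i = lam.
  by move=> ik; rewrite card_ord; apply: g_sym; rewrite eqSS.
have lam_card : lam = 0 \/ (3 < #|'I_n|)%N by rewrite card_ord.
have [f [fP fB fx]] := relfree_model G_sym lam_card
  (fun j => generator_balanced K (v j)).
have W i j k l : uniq [:: i; j; k; l] -> all (letter n) [:: i; j; k; l] ->
    f (dbracket x n i j k l) = (0, 0, quad g i j k l).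
  move=> u al; rewrite (eval_dbracket v_perm_enum fB fx u al).
  by move: al => /= /and5P[il jl kl ll _]; rewrite !GE.
have BW i j : basis_index K n i j -> i != 1%N -> f (basis_elt x n i j) = (0, 0, basis_value g i j).
  rewrite /basis_index /basis_elt /basis_value => ij /negPf i1; rewrite i1.
  case: eqP => [i2|/eqP i2].
    by have [j3|j3] := eqVneq j 3%N; apply: W;
      rewrite /= ?inE /letter; move: ij i1; rewrite /excluded i2 ?j3; lia.
  by apply: W; rewrite /= ?inE /letter; move: ij i1; lia.
have dep1 j : (1 < j <= n)%N -> \sum_(p : 'I_n.+1 * 'I_n.+1)
    a p.1 p.2 * ((p.1 == 1 :> nat) && (p.2 == j :> nat))%:R = 0.
  move=> jn; have := dependence_functional
    (h := fun p => (f p).1.2 (finset.setT, v j)).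
  move=> E; rewrite -[RHS]E => [|b p q]; last by rewrite fP /= !ffunE.
  apply: eq_bigr => -[p q] _; rewrite [_.1]/= [_.2]/=.
  have [pq|pq] := boolP (basis_index K n p q); last by rewrite a_supp // !mul0r.
  congr (_ * _); case: (eqVneq (p : nat) 1%N) => [p1|p1]; last first.
    by rewrite BW // ffunE.
  have q1 : (1 < q <= n)%N by move: pq; rewrite /basis_index p1; lia.
  rewrite p1 (eval_basis_elt1 v_perm_enum fB fx q1) !ffunE !xpair_eqE eqxx !andTb.
  rewrite !v_eq; try by rewrite /letter; lia.
  have -> : (j == 1)%N = false by lia.
  by rewrite subr0 eq_sym.
have a1 j : (1 < j <= n)%N -> a 1%N j = 0.
  move=> jn; have := dep1 j jn.
  rewrite (sum_pick (F := fun p q => ((p == 1%N) && (q == j))%:R) (i0 := 1)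
    (j0 := j)) ?eqxx ?mulr1 //; first by case/andP: jn.
  by move=> p q _; rewrite xpair_eqE => /negPf ->; rewrite mulr0.
split=> //; have := dependence_functional (h := fun p => (f p).2).
move=> E; rewrite -[RHS]E => [|b p q]; last by rewrite fP.
apply: eq_bigr => -[p q] _; rewrite [_.1]/= [_.2]/=.
have [pq|pq] := boolP (basis_index K n p q); last by rewrite a_supp // !mul0r.
case: (eqVneq (p : nat) 1%N) => [p1|p1]; last by rewrite BW.
have q1 : (1 < q <= n)%N by move: pq; rewrite /basis_index p1; lia.
by rewrite p1 a1 // !mul0r.
Qed.

(** The simplest admissible matrix with lam = 0, supported at (i0, j0) and (j0, i0). *)
Definition unit_form i0 j0 (i k : nat) : K :=
  ((i == i0) && (k == j0))%:R - (-1) ^+ n * ((i == j0) && (k == i0))%:R.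

Lemma unit_form_sym i0 j0 i k :
  unit_form i0 j0 i k + (-1) ^+ n * unit_form i0 j0 k i = 0.
Proof.
rewrite /unit_form mulrBr mulrA -expr2 sqrr_sign mul1r.
by rewrite (andbC (k == i0)) (andbC (k == j0)); ring.
Qed.

Lemma dependence_unit_form i0 j0 :
  \sum_(p : 'I_n.+1 * 'I_n.+1) a p.1 p.2 * basis_value (unit_form i0 j0) p.1 p.2 = 0.
Proof.
by have [] := @dependence_values (unit_form i0 j0) 0
  (fun i k _ => unit_form_sym i0 j0 i k) (or_introl erefl).
Qed.

Lemma unit_form0 i0 j0 i k : (i, k) != (i0, j0) -> (i, k) != (j0, i0) ->
  unit_form i0 j0 i k = 0.
Proof.
rewrite !xpair_eqE => /negPf ij /negPf ji.
by rewrite /unit_form ij ji mulr0 subr0.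
Qed.

Lemma unit_form1 i0 j0 : i0 != j0 -> unit_form i0 j0 i0 j0 = 1.
Proof. by move=> /negPf ij; rewrite /unit_form !eqxx ij mulr0 subr0. Qed.

Lemma dependence_row1 j : (1 < j <= n)%N -> a 1%N j = 0.
Proof.
have [+ _] := @dependence_values (unit_form 0 0) 0
  (fun i k _ => unit_form_sym 0 0 i k) (or_introl erefl); exact.
Qed.

(** The matrix supported at (i0, j0) is nonzero on w(1i|2j) only for (i, j) = (i0, j0),
   and on w(14|23) only for (i0, j0) = (3, 4). *)
Lemma dependence_generic i0 j0 : (2 < i0 < j0)%N -> (j0 <= n)%N ->
  (i0, j0) != (3%N, 4%N) -> a i0 j0 = 0.
Proof.
move=> ij jn; rewrite xpair_eqE => ij34.
have := dependence_unit_form i0 j0; rewrite (@sum_pick _ i0 j0); try lia.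
  rewrite /basis_value; have -> : (i0 == 1)%N = false by lia.
  have -> : (i0 == 2)%N = false by lia.
  rewrite /quad unit_form1; last by lia.
  by rewrite !unit_form0 ?subr0 ?add0r ?mulr1 // xpair_eqE; lia.
move=> i j b; rewrite xpair_eqE => ij0.
suff -> : basis_value (unit_form i0 j0) i j = 0 by rewrite mulr0.
move: b; rewrite /basis_index /basis_value => b; case: eqP => // /eqP i1.
case: eqP => i2; first case: eqP => j3; rewrite /quad;
  by rewrite !unit_form0 ?subr0 ?addr0 // xpair_eqE; lia.
Qed.

(** The matrix supported at (3, 4) and (4, 3) sees both w(13|24) and w(14|23). *)
Lemma dependence_34 : (3 < n)%N -> a 3%N 4%N = (-1) ^+ n * a 2%N 3%N.
Proof.
move=> n4; pose d (i0 j0 i j : nat) : K := ((i == i0) && (j == j0))%:R.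
have pick i0 j0 : (i0 <= n)%N -> (j0 <= n)%N ->
    \sum_(p : 'I_n.+1 * 'I_n.+1) a p.1 p.2 * d i0 j0 p.1 p.2 = a i0 j0.
  move=> i0n j0n; rewrite (@sum_pick (d i0 j0) i0 j0) //.
    by rewrite /d !eqxx mulr1.
  by move=> i j _; rewrite xpair_eqE /d => /negPf ->; rewrite mulr0.
apply/eqP; rewrite -subr_eq0; apply/eqP.
rewrite -[RHS](dependence_unit_form 3 4).
have n3 : (3 <= n)%N by lia. have n2 : (2 <= n)%N by lia.
rewrite -(pick _ _ n3 n4) -(pick _ _ n2 n3).
rewrite mulr_sumr -sumrB; apply: eq_bigr => -[i j] _ /=.
have [b|b] := boolP (basis_index K n i j); last by rewrite a_supp // !mul0r mulr0 subr0.
rewrite mulrCA -mulrBr; congr (_ * _); move: b; rewrite /basis_index /basis_value /d => b.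
have [i1|i1] := eqVneq (i : nat) 1%N; first by rewrite i1 /= mulr0 subr0.
have [i2|i2] := eqVneq (i : nat) 2%N.
  have [j3|j3] := eqVneq (j : nat) 3%N; rewrite i2 ?j3 /quad /=.
    rewrite (unit_form0 (i := 1)) // (unit_form0 (i := 1)) //.
    rewrite (unit_form0 (i := 4) (k := 2)) //.
    by rewrite /unit_form /= !subr0 !add0r mulr1.
  rewrite mulr0 subr0.
  by rewrite !unit_form0 ?subr0 ?addr0 // xpair_eqE; lia.
rewrite mulr0 subr0 /quad !(unit_form0 (i := 1)) // (unit_form0 (i := i) (k := 2)).
- rewrite !subr0 add0r /unit_form (_ : (i == 4 :> nat) && _ = false); last by lia.
  by rewrite mulr0 subr0.
- by rewrite xpair_eqE andbF.
- by rewrite xpair_eqE; lia.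
Qed.

(** For n even or in characteristic 2 the matrix g i k = [k < i] is admissible, with
   lam = 1. Modulo 2, its value on w(ij|kl) tells whether the chords ij and kl cross;
   of the spanning elements, only the w(1i|2k) have crossing chords. *)
Lemma dependence_crossing : ~~ excluded K n -> a 3%N 4%N = 0.
Proof.
move=> ex; have [n4|n4] := ltnP 3 n; last first.
  by apply: a_supp; rewrite /basis_index; lia.
pose g (i k : nat) : K := (k < i)%N%:R.
have signE : (-1) ^+ n = 1 :> K.
  move: ex; rewrite /excluded negb_or negb_and -signr_odd => /andP[_].
  case: (odd n) => //=; rewrite negbK -subr_eq0 => /eqP K2.
  by apply/eqP; rewrite expr1 -subr_eq0 -opprD oppr_eq0 -mulr2n -K2 subr0.
have g_sym i k : i != k -> g i k + (-1) ^+ n * g k i = 1.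
  by rewrite signE mul1r /g; case: ltngtP => // _ _; rewrite ?addr0 ?add0r.
have [_ dep] := dependence_values g_sym (or_intror n4).
move: dep; rewrite (@sum_pick _ 3 4); try lia.
  by rewrite /basis_value /quad /g /= !subr0 !addr0 sub0r mulrN1 => /eqP; rewrite oppr_eq0 => /eqP.
move=> i j b; rewrite xpair_eqE => ij.
have [i3|i3] := ltnP 2 i.
  rewrite dependence_generic ?mul0r ?xpair_eqE //;
    by move: b; rewrite /basis_index; lia.
suff -> : basis_value g i j = 0 by rewrite mulr0.
move: b; rewrite /basis_index /basis_value => b; case: eqP => // /eqP i1.
have -> : (i == 2)%N by lia.
case: eqP => j3; rewrite /quad /g.
  by rewrite /= subrr sub0r addNr.
have [j1 j2] : (j < 1)%N = false /\ (j < 2)%N = false by lia.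
by rewrite j1 j2 /= !subr0 addr0.
Qed.

(** If (2, 3) is excluded, its coefficient is 0 and [dependence_34] kills that of (3, 4);
   otherwise [dependence_crossing] starts from the other end. Then the matrix
   supported at (2, j) meets no other coefficient than a 2 j. *)
Lemma dependence_trivial i j : a i j = 0.
Proof.
have [b|/a_supp //] := boolP (basis_index K n i j).
have a34_23 : (3 < n)%N -> a 3%N 4%N = 0 -> a 2%N 3%N = 0.
  move=> n4; rewrite dependence_34 // => /eqP; rewrite mulf_eq0 signr_eq0.
  by move=> /eqP.
have a34 : a 3%N 4%N = 0.
  have [ex|] := boolP (excluded K n); last exact: dependence_crossing.
  have [n4|n4] := ltnP 3 n; last by apply: a_supp; rewrite /basis_index; lia.
  by rewrite dependence_34 // a_supp ?mulr0 // /basis_index ex andbF.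
have a23 : a 2%N 3%N = 0.
  have [n4|n4] := ltnP 3 n; first exact: a34_23.
  by apply: a_supp; rewrite /basis_index /excluded; lia.
have ge3 i' j' : (2 < i')%N -> a i' j' = 0.
  have [b'|/a_supp //] := boolP (basis_index K n i' j') => i3.
  have [/eqP[-> ->] //|ij] := boolP ((i', j') == (3%N, 4%N)).
  by apply: dependence_generic => //; move: b'; rewrite /basis_index; lia.
have [i3|i3] := ltnP 2 i; first exact: ge3.
have [i1|i1] := eqVneq i 1%N.
  by rewrite i1; apply: dependence_row1; move: b; rewrite /basis_index; lia.
have i2 : i = 2%N by move: b; rewrite /basis_index; lia.
have [->|j3] := eqVneq j 3%N; first by rewrite i2.
rewrite i2; have := dependence_unit_form 2 j.
have j4 : (3 < j <= n)%N by move: b; rewrite /basis_index; lia.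
rewrite (@sum_pick _ 2 j); try lia.
  rewrite /basis_value /= (negPf j3) /quad unit_form1; last by lia.
  by rewrite !unit_form0 ?subr0 ?add0r ?mulr1 // xpair_eqE; lia.
move=> i' j' b'; rewrite xpair_eqE => ij.
have [i'3|i'3] := ltnP 2 i'; first by rewrite ge3 ?mul0r.
have [->|j'3] := eqVneq j' 3%N.
  have [->|i'2] := eqVneq i' 2%N; first by rewrite a23 mul0r.
  have -> : i' = 1%N by move: b'; rewrite /basis_index; lia.
  by rewrite /basis_value /= mulr0.
suff -> : basis_value (unit_form 2 j) i' j' = 0 by rewrite mulr0.
move: b'; rewrite /basis_index /basis_value (negPf j'3) => b'; case: eqP => // /eqP i'1.
have i'2 : i' = 2%N by lia.
rewrite i'2 /= /quad.
by rewrite !unit_form0 ?subr0 ?addr0 // xpair_eqE; lia.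
Qed.

End Independence.

(** * Codimensions and the complexity function *)

Section Codimension.
Variable K : fieldType.
Local Notation CBM := (centre_by_metabelian K).
Local Notation x := (@relfree_gen K CBM).

Lemma relfree_cbm (a b c d e : relfree CBM) :
  bracket (bracket (bracket a b) (bracket c d)) e = 0.
Proof.
(* the variables of the identity are numbered from 1 *)
pose w := nth 0 [:: 0; a; b; c; d; e].
by have := @relfree_in_variety K CBM _ erefl w.
Qed.

Definition basis_indices n :=
  {p : 'I_n.+1 * 'I_n.+1 | basis_index K n p.1 p.2}.

Lemma multilinear_span n : (1 < n)%N ->
  lin_span (range (fun t : basis_indices n => basis_elt x n (val t).1 (val t).2)) =
  multilinear CBM n.
Proof.
move=> n1; apply/seteqP; split; apply: lin_span_sub; try exact: submodule_lin_span.
- move=> _ [[[i j] ij] _ <-]; have [m mn mE] := basis_elt_monomial x n1 ij.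
  by apply: lin_span_gen; exists m.
- move=> _ [m mn <-]; apply: (monomial_in relfree_cbm) n1 mn => //.
    exact: submodule_lin_span.
  move=> i j ij; apply: lin_span_gen.
  have [iN jN] : (i < n.+1)%N /\ (j < n.+1)%N by move: ij; rewrite /basis_index; lia.
  by exists (exist _ (Ordinal iN, Ordinal jN) ij).
Qed.

(** Column j contains the j - 1 pairs (i, j) with 0 < i < j, whence C(n, 2); at most
   the pair (2, 3) is missing. *)
Lemma card_basis_indices n : (1 < n)%N ->
  #|{: basis_indices n}| = ('C(n, 2) - excluded K n)%N.
Proof.
move=> n1; rewrite card_sig.
have cardC : #|[pred p : 'I_n.+1 * 'I_n.+1 | (0 < p.1 < p.2)%N]| = 'C(n, 2).
  transitivity (\sum_(i < n.+1) \sum_(j < n.+1 | (0 < i < j)%N) 1)%N.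
    by rewrite pair_big_dep -sum1_card; apply: eq_bigl.
  rewrite (exchange_big_dep xpredT) //= -bin2_sum big_mkord.
  have row (j : 'I_n.+1) : (\sum_(i < n.+1 | (0 < i < j)%N) 1 = j.-1)%N.
    transitivity (\sum_(1 <= i < j) 1)%N; last first.
      by rewrite sum_nat_const_nat muln1 subn1.
    rewrite (big_nat_widen _ _ n.+1) ?big_geq_mkord; last exact: ltnW (ltn_ord j).
    by apply: eq_bigl => i; rewrite andbC.
  by rewrite (eq_bigr _ (fun j _ => row j)) big_ord_recl add0n.
case: (boolP (excluded K n)) => ex; last first.
  rewrite subn0 -cardC; apply: eq_card => -[i j]; rewrite !inE /basis_index /=.
  by have := ltn_ord j; rewrite (negPf ex) /=; lia.
have n3 : (2 < n)%N by move: ex; rewrite /excluded; lia.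
have [lt2 lt3] : (2 < n.+1)%N /\ (3 < n.+1)%N by lia.
rewrite -cardC [X in (X - _)%N](cardD1 (Ordinal lt2, Ordinal lt3)) inE /= add1n subn1 /=.
apply: eq_card => -[i j]; rewrite !inE /basis_index ex /= xpair_eqE -!val_eqE /=.
by have := ltn_ord j; lia.
Qed.

Lemma codimension_ge2 n : (1 < n)%N ->
  codimension CBM n = ('C(n, 2) - excluded K n)%N.
Proof.
move=> n1; rewrite -card_basis_indices //.
apply: dimension_finType (multilinear_span n1) => a a0 t.
case: n n1 a a0 t => [|[|m]] // _ a a0 t.
set n := m.+2 in a a0 t *.
(* extend the coefficients by 0 to all pairs of natural numbers *)
pose a' i j :=
  \sum_(s : basis_indices n | ((val s).1 == i :> nat) && ((val s).2 == j :> nat)) a s.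
have a'E i j : a' i j = 0.
  apply: (@dependence_trivial K m) => [{}i {}j ij|].
    rewrite /a' big_pred0 // => u; apply: contraNF ij => /andP[/eqP <- /eqP <-].
    exact: (valP u).
  rewrite -[RHS]a0 (partition_big val xpredT) //=; apply: eq_bigr => -[i' j'] _.
  rewrite /a' scaler_suml; apply: eq_big => [u|u /andP[/eqP -> /eqP ->] //].
  by rewrite -pair_eqE /=.
rewrite -(a'E (val t).1 (val t).2) /a' (bigD1 t) ?eqxx //= big1 ?addr0 //.
move=> u /andP[/andP[/eqP e1 /eqP e2]]; case/eqP; apply: val_inj.
by apply: injective_projections; apply: val_inj.
Qed.

(** The algebra on one generator with zero form already distinguishes x_j from 0. *)
Lemma relfree_gen_neq0 j : x j != 0.
Proof.
have G_sym (i k : 'I_1) : i != k -> 0 + (-1) ^+ #|'I_1| * 0 = 0 :> K.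
  by rewrite mulr0 addr0.
have [f [fP _ fx]] := relfree_model G_sym (or_introl erefl)
  (fun _ : nat => generator_balanced K ord0).
have f0 : f 0 = 0.
  apply: (addrI (1 *: f 0)); rewrite -fP scaler0 addr0.
  by rewrite scale1r addr0.
apply/eqP => x0; have := fx j; rewrite x0 f0.
move=> /(congr1 (fun e => e.1.1 : {ffun 'I_1 -> K^o})) /= /ffunP /(_ ord0).
rewrite !ffunE => /eqP.
by rewrite eq_sym oner_eq0.
Qed.

Lemma codimension1 : codimension CBM 1 = 1%N.
Proof.
rewrite -[RHS]card_unit; apply: (dimension_finType (b := fun=> x 1)).
  move=> a; rewrite (bigD1 tt) //= big1 ?addr0 => [|[]] //.
  by move=> /eqP; rewrite scaler_eq0 (negPf (relfree_gen_neq0 1)) orbF => /eqP a0 [].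
apply/seteqP; split; apply: lin_span_sub; try exact: submodule_lin_span.
  move=> _ [_ _ <-]; apply: lin_span_gen; exists (MVar 1) => //.
move=> _ [m mn <-]; apply: monomial_left_normed; first exact: submodule_lin_span.
move=> i s ps; have := perm_trans ps mn.
move=> p; have := perm_size p; case: s p {ps} => // /perm_mem /(_ i) + _.
rewrite !inE eqxx => /esym /eqP ->.
by apply: lin_span_gen; exists tt.
Qed.

End Codimension.

Section Coefficients.
Variable R : realType.

Lemma zpow2_exp_coef n : (2 <= n)%N ->
  series_scale 2^-1 (series_mul (zpow 2) series_exp) n = 'C(n, 2)%:R / n`!%:R :> R.
Proof.
move=> n2; rewrite /series_scale /series_mul.
have n3 : (2 < n.+1)%N by [].
rewrite (bigD1 (Ordinal n3)) //= big1 ?addr0 => [|i i2]; last first.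
  rewrite /zpow; have -> : (i == 2 :> nat) = false.
    by apply: contraNF i2 => /eqP e; apply/eqP/val_inj.
  by rewrite mul0r.
rewrite /zpow /series_exp eqxx mul1r.
have f0 k : k`!%:R != 0 :> R by rewrite Num.Theory.pnatr_eq0 -lt0n fact_gt0.
have := bin_fact n2 => /(congr1 (fun k => k%:R : R)); rewrite !natrM => <-.
have C0 : 'C(n, 2)%:R != 0 :> R by rewrite Num.Theory.pnatr_eq0 -lt0n bin_gt0.
rewrite !mulr1.
by field; rewrite f0 C0.
Qed.

Lemma sinh_coef n : series_sinh n = (odd n)%:R / n`!%:R :> R.
Proof.
rewrite /series_sinh /series_scale.
transitivity (2^-1 * (n`!%:R^-1 - (-1) ^+ n * n`!%:R^-1) : R); first by [].
have K2 : 2 != 0 :> R by rewrite Num.Theory.pnatr_eq0.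
rewrite -signr_odd; case: (odd n); last by rewrite mul1r subrr mulr0 mul0r.
by rewrite mulN1r opprK mul1r -[X in X + X]mul1r -mulrDl mulrA mulVf // mul1r.
Qed.

End Coefficients.

Theorem theorem5p1 (R : realType) (K : fieldType) :
  [/\ series_le (complexity R (centre_by_metabelian K))
        (series_scale 2^-1 (series_mul (zpow 2) series_exp) + zpow 1
           - series_scale 6^-1 (zpow 3)),
      2%N \in [pchar K] ->
        complexity R (centre_by_metabelian K) =
        series_scale 2^-1 (series_mul (zpow 2) series_exp) + zpow 1
          - series_scale 6^-1 (zpow 3)
    & 2%N \notin [pchar K] ->
        complexity R (centre_by_metabelian K) =
        series_scale 2^-1 (series_mul (zpow 2) series_exp)
          + series_scale 2 (zpow 1) - series_sinh].
Proof.
pose E : nat -> R := series_scale 2^-1 (series_mul (zpow 2) series_exp).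
have E0 n : (n < 2)%N -> E n = 0.
  move=> n2; rewrite /E /series_scale /series_mul big1 ?mulr0 // => i _.
  by rewrite /zpow (_ : (i == 2 :> nat) = false) ?mul0r //; have := ltn_ord i; lia.
pose u n : R := (E + zpow 1 - series_scale 6^-1 (zpow 3)) n.
have uE n : u n = E n + (n == 1%N)%:R - 6^-1 * (n == 3%N)%:R by [].
have char2 : (2%N \in [pchar K]) = (2 == 0 :> K) by rewrite inE.
have cE n : (1 < n)%N -> complexity R (centre_by_metabelian K) n =
    E n - (excluded K n)%:R / n`!%:R.
  move=> n1; rewrite /complexity ltnW // codimension_ge2 // /E zpow2_exp_coef //.
  rewrite natrB ?mulrBl // /excluded.
  have [->|n3] := eqVneq n 3%N; first by [].
  by rewrite (leq_trans (leq_b1 _)) // bin_gt0.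
have c1 : complexity R (centre_by_metabelian K) 1 = 1.
  by rewrite /complexity /= codimension1 divr1.
have c0 : complexity R (centre_by_metabelian K) 0 = 0 by [].
have six : 3`!%:R = 6 :> R by [].
have u3 : u 3%N = E 3%N - 1 / 3`!%:R.
  by rewrite uE addr0 mulr1 six mul1r.
have c_eq n : n != 3%N -> excluded K n = false ->
    complexity R (centre_by_metabelian K) n = u n.
  move=> n3 ex; rewrite uE (negPf n3) mulr0 subr0.
  case: n n3 ex => [|[|n]] n3 ex; first by rewrite c0 E0 // addr0.
    by rewrite c1 E0 // add0r.
  by rewrite cE // ex mul0r subr0 addr0.
have c_3 : complexity R (centre_by_metabelian K) 3 = u 3%N by rewrite cE // u3.
split=> [n|K2|K2].
- have [->|n3] := eqVneq n 3%N; first by rewrite c_3.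
  case ex: (excluded K n); last by rewrite c_eq.
  rewrite -[X in _ <= X]/(u n) uE (negPf n3) mulr0 subr0.
  case: n n3 ex => [|[|n]] n3 ex; first by rewrite c0 E0 // addr0.
    by rewrite c1 E0 // add0r.
  rewrite cE // addr0 ex Num.Theory.gerBl.
  by apply: Num.Theory.divr_ge0; exact: Num.Theory.ler0n.
- apply/funext => n; have [->|n3] := eqVneq n 3%N; first exact: c_3.
  by apply: c_eq => //; rewrite /excluded (negPf n3) -char2 K2 andbF.
- apply/funext => n.
  transitivity (E n + 2 * (n == 1%N)%:R - (odd n)%:R / n`!%:R); last first.
    by rewrite -sinh_coef.
  case: n => [|[|n]]; first by rewrite c0 E0 // mulr0 addr0 mul0r subrr.
    by rewrite c1 E0 // add0r /= divr1; ring.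
  rewrite cE // mulr0 addr0 /excluded -char2 K2 andbT.
  by case: eqP => // ->.
Qed.
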